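(* Let $S = \{x \in \mathbb{R}^n \mid \exists\, y \in \mathbb{R}^m : A_0 + \mathcal{A}(x) + \mathcal{B}(y) \succcurlyeq 0\}$ be a spectrahedral shadow, let $\bar{x} \in \operatorname{int} S$ be a point for which there exists $y_{\bar{x}} \in \mathbb{R}^m$ with $A_0 + \mathcal{A}(\bar{x}) + \mathcal{B}(y_{\bar{x}}) \succ 0$, and let $\delta > 0$. Then Algorithm H (described in the context), applied to $S$, $\bar{x}$ and $\delta$, works correctly; in particular, it terminates after finitely many steps and returns an outer homogeneous $\delta$-approximation $P_{\mathsf{O}}$ of $S$ and an inner homogeneous $\delta$-approximation $P_{\mathsf{I}}$ of $S$.
   Context: **Notation.** $\mathcal{S}^{\ell}$ is the space of real symmetric $\ell \times \ell$ matrices; $X \succcurlyeq 0$ and $X \succ 0$ mean positive semidefinite and positive definite; $X \bullet Y = \operatorname{tr}(XY)$. A spectrahedral shadow in $\mathbb{R}^n$ is a set of the form $\{x \in \mathbb{R}^n \mid \exists\, y \in \mathbb{R}^m : A_0 + \mathcal{A}(x) + \mathcal{B}(y) \succcurlyeq 0\}$ with $A_0 \in \mathcal{S}^{\ell}$ and linear maps $\mathcal{A}: \mathbb{R}^n \to \mathcal{S}^{\ell}$, $\mathcal{B}: \mathbb{R}^m \to \mathcal{S}^{\ell}$; $\mathcal{A}(x) = \sum_i A_i x_i$ and its adjoint is $\mathcal{A}^{\mathsf{T}}(V) = (A_1 \bullet V, \dots, A_n \bullet V)^{\mathsf{T}}$, and similarly for $\mathcal{B}$. $H(\omega,\gamma)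 = \{x \mid \omega^{\mathsf{T}} x = \gamma\}$, $H^-(\omega,\gamma) = \{x \mid \omega^{\mathsf{T}} x \leq \gamma\}$. $\operatorname{vert}$ denotes the set of vertices (extreme points) of a polyhedron. $\operatorname{cone} M$ is the smallest convex cone containing $M$ (cones contain $0$; $\operatorname{cone}\emptyset=\{0\}$). $B$ is the closed Euclidean unit ball. **Homogeneous approximations.** For convex $C \subseteq \mathbb{R}^n$, $\operatorname{homog} C = \operatorname{cl}\operatorname{cone}(C \times \{1\}) \subseteq \mathbb{R}^{n+1}$. The Hausdorff distance is $d_{\mathsf{H}}(C_1,C_2) = \max\{\sup_{x \in C_1} d(x,C_2), \sup_{x \in C_2} d(x,C_1)\}$ with $d(x,M) = \inf_{y \in M}\|x-y\|$, and for convex cones $d_{\mathsf{tH}}(K_1,K_2) = d_{\mathsf{H}}(K_1 \cap B, K_2 \cap B)$. A polyhedron $P \subseteq \mathbb{R}^n$ is a homogeneous $\delta$-approximation of $C$ if $d_{\mathsf{tH}}(\operatorname{homog} P, \operatorname{homog} C) \leq \delta$. It is called outer if $\operatorname{cl} C \subseteq P$, and inner if $P \subseteq \operatorname{cl} C$. **Semidefinite programs.** For a spectrahedral shadow $T \subseteq \mathbb{R}^N$ given by data $A_0, \mathcal{A}, \mathcal{B}$ (with auxiliary variable $y$), and $p,d \in \mathbb{R}^N$, let (P$(p,d,T)$): maximize $t$ over $(t,x,y)$ subject to $A_0 + \mathcal{A}(x) + \mathcal{B}(y) \succcurlyeq 0$, $x = p + td$; (D$(p,d,T)$): minimize $(A_0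 + \mathcal{A}(p)) \bullet V$ over $(V,w)$ subject to $-\mathcal{A}^{\mathsf{T}}(V) = w$, $-\mathcal{B}^{\mathsf{T}}(V) = 0$, $V \succcurlyeq 0$, $d^{\mathsf{T}} w = 1$. ''Compute a solution'' means obtain an (arbitrary) exact optimal solution; ''unbounded'' means the supremum is $+\infty$. **Algorithm R** (recession cone approximation; input: a spectrahedral shadow $T \subseteq \mathbb{R}^N$, a point $p$, a direction $\bar{d}$, a tolerance $\delta > 0$; output: polyhedral cones $K_{\mathsf{O}}, K_{\mathsf{I}}$). 1. If P$(p,-\bar{d},T)$ is unbounded, set $K_{\mathsf{O}} = K_{\mathsf{I}} = \mathbb{R}^N$ and return. Otherwise compute a solution $(V,w)$ to D$(p,-\bar{d},T)$ and set $K_{\mathsf{O}} := H^-(w,0)$, $K_{\mathsf{I}} := \operatorname{cone}\{\bar{d}\}$. 2. Repeat until stop = true at the end of a pass: set stop := true; for each $r \in \operatorname{vert}\{x \in K_{\mathsf{O}} \mid \|x\|_{\infty} \leq 1\} \setminus \{0\}$ (with $K_{\mathsf{O}}$ as at the start of the pass), and for $k = 1, \dots, \lceil \log_2(\|r - \bar{d}\|/\delta) \rceil$ (no iteration if this number is less than $1$): let $d := \frac{2^k-1}{2^k} r + \frac{1}{2^k}\bar{d}$; if P$(p,d,T)$ is unbounded, set $K_{\mathsf{I}} := \operatorname{cone}(K_{\mathsf{I}} \cup \{d\})$; otherwise compute a solution $(V_d,w_d)$ to D$(p,d,T)$, set $K_{\mathsf{O}} := K_{\mathsf{O}} \cap H^-(w_d,0)$,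 set stop := false, and leave the loop over $k$ (continuing with the next $r$). **Algorithm H** (input: $S$, $\bar{x}$, $\delta$). 1. Let $K := \operatorname{cone}(S \times \{1\}) \subseteq \mathbb{R}^{n+1}$, which (up to closure) is handled through its representation as the spectrahedral shadow of all $(x,x_{n+1}) \in \mathbb{R}^n \times \mathbb{R}$ for which there exist $y \in \mathbb{R}^m$, $t \in \mathbb{R}$ with $\mathcal{A}(x) + A_0 x_{n+1} + \mathcal{B}(y) \succcurlyeq 0$ and $\begin{pmatrix} x_{n+1} I & x \\ x^{\mathsf{T}} & t \end{pmatrix} \succcurlyeq 0$ (where $I$ is the $n \times n$ identity matrix; the two constraints are combined block-diagonally). 2. Compute $K_{\mathsf{O}}, K_{\mathsf{I}}$ by applying Algorithm R to $T = K$ with $p = (\bar{x}^{\mathsf{T}},1)^{\mathsf{T}}$, $\bar{d} = p/\|p\|$ and tolerance $\delta$. 3. Return $P_{\mathsf{O}} := \pi[K_{\mathsf{O}} \cap H(e_{n+1},1)]$ and $P_{\mathsf{I}} := \pi[K_{\mathsf{I}} \cap H(e_{n+1},1)]$, where $\pi: \mathbb{R}^{n+1} \to \mathbb{R}^n$, $\pi(x,x_{n+1}) = x$, and $e_{n+1}$ is the last standard unit vector. *)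

(* Defs.v *)
From HB Require Import structures.
From mathcomp Require Import all_boot all_order all_algebra.
From mathcomp Require Import boolp classical_sets reals ereal topology.
From mathcomp Require Import normedtype exp.
From Stdlib Require Import Relation_Operators.

Set Implicit Arguments.
Unset Strict Implicit.
Unset Printing Implicit Defensive.

Import Order.TTheory GRing.Theory Num.Theory numFieldNormedType.Exports.

Local Open Scope classical_set_scope.
Local Open Scope ring_scope.

(* Points of R^n are column vectors.  The library norm `|x| on 'cV[R]_n is
   the maximum norm; the Euclidean norm is [enorm]. *)

Section Euclidean.
Context {R : realType}.

Definition dot n (u v : 'cV[R]_n) : R := (u^T *m v) 0 0.

Definition enorm n (x : 'cV[R]_n) : R := Num.sqrt (dot x x).

Definition eball n : set 'cV[R]_n := [set x | enorm x <= 1].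

Definition hyperplane n (w : 'cV[R]_n) (g : R) : set 'cV[R]_n :=
  [set x | dot w x = g].

Definition halfspace n (w : 'cV[R]_n) (g : R) : set 'cV[R]_n :=
  [set x | dot w x <= g].

Definition polyhedron n (P : set 'cV[R]_n) : Prop :=
  exists hs : seq ('cV[R]_n * R),
    P = [set x | forall h, h \in hs -> halfspace h.1 h.2 x].

Definition vert n (P : set 'cV[R]_n) : set 'cV[R]_n :=
  [set x | P x /\ forall y z t, P y -> P z -> 0 < t < 1 ->
                    x = t *: y + (1 - t) *: z -> y = z].

Definition convex_cone n (K : set 'cV[R]_n) : Prop :=
  [/\ K 0,
      forall x y, K x -> K y -> K (x + y) &
      forall a x, 0 <= a -> K x -> K (a *: x)].

Definition cone n (M : set 'cV[R]_n) : set 'cV[R]_n :=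
  smallest (@convex_cone n) M.

End Euclidean.

Section HomogeneousApproximation.
Context {R : realType}.

(* Extended-real infima and suprema, so that no default value is involved
   for empty or unbounded sets. *)
Definition dist n (x : 'cV[R]_n) (M : set 'cV[R]_n) : \bar R :=
  ereal_inf [set (enorm (x - y))%:E | y in M].

Definition hausdorff n (C1 C2 : set 'cV[R]_n) : \bar R :=
  maxe (ereal_sup [set dist x C2 | x in C1])
       (ereal_sup [set dist x C1 | x in C2]).

Definition dtH n (K1 K2 : set 'cV[R]_n) : \bar R :=
  hausdorff (K1 `&` eball (n:=n)) (K2 `&` eball (n:=n)).

Definition lift1 n (C : set 'cV[R]_n) : set 'cV[R]_(n + 1) :=
  [set col_mx x 1 | x in C].

Definition homog n (C : set 'cV[R]_n) : set 'cV[R]_(n + 1) :=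
  closure (cone (lift1 C)).

Definition homog_approx n (delta : R) (C P : set 'cV[R]_n) : Prop :=
  polyhedron P /\ (dtH (homog P) (homog C) <= delta%:E)%E.

Definition outer_homog_approx n (delta : R) (C P : set 'cV[R]_n) : Prop :=
  homog_approx delta C P /\ closure C `<=` P.

Definition inner_homog_approx n (delta : R) (C P : set 'cV[R]_n) : Prop :=
  homog_approx delta C P /\ P `<=` closure C.

End HomogeneousApproximation.

Section SemidefinitePrograms.
Context {R : realType}.

Definition psd l (M : 'M[R]_l) : Prop :=
  M^T = M /\ forall v : 'cV[R]_l, 0 <= dot v (M *m v).

Definition pd l (M : 'M[R]_l) : Prop :=
  M^T = M /\ forall v : 'cV[R]_l, v != 0 -> 0 < dot v (M *m v).

Definition mxdot l (X Y : 'M[R]_l) : R := \tr (X *m Y).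

Record shadow_data (n m l : nat) := ShadowData {
  sd_A0 : 'M[R]_l;
  sd_A : 'I_n -> 'M[R]_l;
  sd_B : 'I_m -> 'M[R]_l
}.

Definition sym_data n m l (D : shadow_data n m l) : Prop :=
  [/\ (sd_A0 D)^T = sd_A0 D,
      forall i, (sd_A D i)^T = sd_A D i &
      forall j, (sd_B D j)^T = sd_B D j].

Definition linmap n l (A : 'I_n -> 'M[R]_l) (x : 'cV[R]_n) : 'M[R]_l :=
  \sum_i x i 0 *: A i.

Definition adjoint n l (A : 'I_n -> 'M[R]_l) (V : 'M[R]_l) : 'cV[R]_n :=
  \col_i mxdot (A i) V.

Definition pencil n m l (D : shadow_data n m l) (x : 'cV[R]_n)
    (y : 'cV[R]_m) : 'M[R]_l :=
  sd_A0 D + linmap (sd_A D) x + linmap (sd_B D) y.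

Definition shadow n m l (D : shadow_data n m l) : set 'cV[R]_n :=
  [set x | exists y, psd (pencil D x y)].

Section Programs.
Variables (N M L : nat) (T : shadow_data N M L) (p d : 'cV[R]_N).

Definition P_feasible (t : R) (x : 'cV[R]_N) (y : 'cV[R]_M) : Prop :=
  psd (pencil T x y) /\ x = p + t *: d.

Definition P_unbounded : Prop :=
  forall c : R, exists t x y, P_feasible t x y /\ c <= t.

Definition D_feasible (V : 'M[R]_L) (w : 'cV[R]_N) : Prop :=
  [/\ - adjoint (sd_A T) V = w, - adjoint (sd_B T) V = 0,
      psd V & dot d w = 1].

Definition D_value (V : 'M[R]_L) : R :=
  mxdot (sd_A0 T + linmap (sd_A T) p) V.

Definition D_solution (V : 'M[R]_L) (w : 'cV[R]_N) : Prop :=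
  D_feasible V w /\
  forall V' w', D_feasible V' w' -> D_value V <= D_value V'.

End Programs.
End SemidefinitePrograms.

(* The algorithms are nondeterministic (choice of the dual solutions, order
   in which the vertices are visited), so they are transition systems; a run
   is a sequence of consecutive steps starting in [Init]. *)
Section AlgorithmR.
Context {R : realType}.

Inductive stateR (N : nat) :=
  | Init
  | Pass of set 'cV[R]_N & set 'cV[R]_N
    (* Pass KO KI : about to start a pass *)
  | ForVert of set 'cV[R]_N & set 'cV[R]_N & seq 'cV[R]_N & bool
    (* ForVert KO KI rs stop : rs are the vertices still to be visited *)
  | ForK of set 'cV[R]_N & set 'cV[R]_N & 'cV[R]_N & nat
            & seq 'cV[R]_N & bool
    (* ForK KO KI r k rs stop : loop over k for r, rs remain after r *)
  | Done of set 'cV[R]_N & set 'cV[R]_N.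

Arguments Init {N}.

Section Steps.
Variables (N M L : nat) (T : shadow_data (R:=R) N M L).
Variables (p dbar : 'cV[R]_N) (delta : R).

Definition box_vertices (K : set 'cV[R]_N) : set 'cV[R]_N :=
  [set r | vert (K `&` [set x | `|x| <= 1]) r /\ r != 0].

(* Since ln 0 = 0 in the library, this is 0 for r = dbar, which gives no
   iteration, as does the convention log2 0 = -oo. *)
Definition niter (r : 'cV[R]_N) : int :=
  Num.ceil (ln (enorm (r - dbar) / delta) / ln 2).

Definition dir (r : 'cV[R]_N) (k : nat) : 'cV[R]_N :=
  ((2 ^+ k - 1) / 2 ^+ k) *: r + (1 / 2 ^+ k) *: dbar.

Inductive stepR : stateR N -> stateR N -> Prop :=
  | InitUnbounded :
      P_unbounded T p (- dbar) ->
      stepR Init (Done setT setT)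
  | InitBounded V w :
      ~ P_unbounded T p (- dbar) ->
      D_solution T p (- dbar) V w ->
      stepR Init (Pass (halfspace w 0) (cone [set dbar]))
  | PassStart KO KI rs :
      uniq rs -> (forall r, r \in rs <-> box_vertices KO r) ->
      stepR (Pass KO KI) (ForVert KO KI rs true)
  | PassStop KO KI :
      stepR (ForVert KO KI [::] true) (Done KO KI)
  | PassAgain KO KI :
      stepR (ForVert KO KI [::] false) (Pass KO KI)
  | VertNext KO KI r rs stop :
      stepR (ForVert KO KI (r :: rs) stop) (ForK KO KI r 1 rs stop)
  | KEnd KO KI r k rs stop :
      niter r < k%:Z ->
      stepR (ForK KO KI r k rs stop) (ForVert KO KI rs stop)
  | KUnbounded KO KI r k rs stop :
      k%:Z <= niter r ->
      P_unbounded T p (dir r k) ->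
      stepR (ForK KO KI r k rs stop)
            (ForK KO (cone (KI `|` [set dir r k])) r k.+1 rs stop)
  | KCut KO KI r k rs stop V w :
      k%:Z <= niter r ->
      ~ P_unbounded T p (dir r k) ->
      D_solution T p (dir r k) V w ->
      stepR (ForK KO KI r k rs stop)
            (ForVert (KO `&` halfspace w 0) KI rs false).

End Steps.
End AlgorithmR.

Arguments Init {R N}.

Section AlgorithmH.
Context {R : realType}.
Section Defs.
Variables (n m l : nat) (D : shadow_data (R:=R) n m l).

(* The coefficients of the variables x_i, x_(n+1), y_j, t in the
   representation of cone (S x {1}); see [pencil_cone_data]. *)
Definition cone_data : shadow_data (n + 1) (m + 1) (l + (n + 1)) :=
  ShadowData 0
    (fun i => match split i with
       | inl i => block_mx (sd_A D i) 0 0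
                    (block_mx 0 (delta_mx i 0) (delta_mx 0 i) 0)
       | inr _ => block_mx (sd_A0 D) 0 0 (block_mx 1%:M 0 0 0)
       end)
    (fun j => match split j with
       | inl j => block_mx (sd_B D j) 0 0 0
       | inr _ => block_mx 0 0 0 (block_mx 0 0 0 1%:M)
       end).

Lemma pencil_cone_data (x : 'cV[R]_n) (s : R) (y : 'cV[R]_m) (t : R) :
  pencil cone_data (col_mx x s%:M) (col_mx y t%:M) =
  block_mx (linmap (sd_A D) x + s *: sd_A0 D + linmap (sd_B D) y) 0
           0 (block_mx s%:M x x^T t%:M).
Proof.
have splitl k (i : 'I_k) : split (lshift 1 i) = inl i := unsplitK (inl i).
have splitr k (i : 'I_1) : split (rshift k i) = inr i := unsplitK (inr i).
have sumb I (r : seq I) (p q p' q' : nat) (F : I -> 'M[R]_(p, q)) G H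
    (K : I -> 'M[R]_(p', q')) :
    \sum_(i <- r) block_mx (F i) (G i) (H i) (K i) =
    block_mx (\sum_(i <- r) F i) (\sum_(i <- r) G i)
             (\sum_(i <- r) H i) (\sum_(i <- r) K i).
  elim: r => [|i r IH]; last by rewrite !big_cons IH add_block_mx.
  by rewrite !big_nil block_mx0.
have colx : \sum_i x i 0 *: delta_mx i 0 = x.
  by rewrite [RHS]matrix_sum_delta; apply: eq_bigr => i _; rewrite big_ord1.
have rowx : \sum_i x i 0 *: delta_mx 0 i = x^T.
  by rewrite [RHS]row_sum_delta; apply: eq_bigr => i _; rewrite mxE.
have EA : linmap (sd_A cone_data) (col_mx x s%:M) =
    block_mx (linmap (sd_A D) x + s *: sd_A0 D) 0 0
             (block_mx s%:M x x^T 0).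
  rewrite /linmap big_split_ord big_ord1.
  under eq_bigr => i _.
    rewrite col_mxEu /= splitl !scale_block_mx !scaler0.
    over.
  rewrite !sumb !big1_eq colx rowx col_mxEd /= splitr mxE eqxx mulr1n.
  by rewrite !scale_block_mx !scaler0 !add_block_mx !addr0 !add0r scalemx1.
have EB : linmap (sd_B cone_data) (col_mx y t%:M) =
    block_mx (linmap (sd_B D) y) 0 0 (block_mx 0 0 0 t%:M).
  rewrite /linmap big_split_ord big_ord1.
  under eq_bigr => i _.
    rewrite col_mxEu /= splitl !scale_block_mx !scaler0.
    over.
  rewrite !sumb !big1_eq col_mxEd /= splitr mxE eqxx mulr1n.
  by rewrite !scale_block_mx !scaler0 !add_block_mx !addr0 !add0r scalemx1.
by rewrite /pencil EA EB add0r !add_block_mx !addr0 !add0r.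
Qed.

Variables (xbar : 'cV[R]_n) (delta : R).

Definition startH : 'cV[R]_(n + 1) := col_mx xbar 1.

Definition stepH : stateR (n + 1) -> stateR (n + 1) -> Prop :=
  stepR cone_data startH ((enorm startH)^-1 *: startH) delta.

Definition reachableH (s : stateR (n + 1)) : Prop :=
  clos_refl_trans _ stepH Init s.

(* Every computation demanded by the algorithm can be carried out. *)
Definition never_stuckH : Prop :=
  forall s, reachableH s ->
    (exists KO KI, s = Done KO KI) \/ (exists s', stepH s s').

Definition terminatesH : Prop :=
  ~ exists f : nat -> stateR (n + 1),
      f 0%N = Init /\ forall i, stepH (f i) (f i.+1).

Definition slice (K : set 'cV[R]_(n + 1)) : set 'cV[R]_n :=
  [set usubmx x | x in K `&` hyperplane (col_mx 0 1) 1].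

Definition returnsH (PO PI : set 'cV[R]_n) : Prop :=
  exists KO KI,
    [/\ reachableH (Done KO KI), PO = slice KO & PI = slice KI].

End Defs.
End AlgorithmH.

(* Main.v *)
Require Import Defs.
From HB Require Import structures.
From mathcomp Require Import all_boot all_order all_algebra.
From mathcomp Require Import boolp classical_sets reals ereal topology.
From mathcomp Require Import normedtype exp derive.
From mathcomp Require Import ring lra.
From Stdlib Require Import Relation_Operators Operators_Properties.

Set Implicit Arguments.
Unset Strict Implicit.
Unset Printing Implicit Defensive.

Import Order.TTheory GRing.Theory Num.Theory numFieldNormedType.Exports.

Local Open Scope classical_set_scope.
Local Open Scope ring_scope.

(* The cone T over S x {1} is a spectrahedral shadow with p = (xbar, 1) in its
   interior.  A dual feasible w for a direction d satisfies w <= 0 on T,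
   w p < 0 and w d = 1, so each cut keeps T and removes d; strong duality under
   Slater's condition provides the dual solutions.
   Termination: a direction found after the cut is (1 - 2^-k) r + 2^-k dbar with
   w r <= 0 and k bounded, and |w| is at most a multiple of - w p, hence it is
   at a distance from d bounded below by a constant.  Directions are bounded, so
   only finitely many cuts occur.
   Correctness: after a pass without cuts every vertex of K_O in the box is
   within delta of K_I, hence so is the convex hull of these vertices, which
   contains the part of K_O in the Euclidean ball; and K_I <= cl T <= K_O. *)

(** The dual solutions are arbitrary, so nothing is known of a normal w beyond dual feasibility, and
    every estimate has to be uniform in w. Comparing the size of w with - w p achieves this: both
    scale alike, and the ratio is bounded because T contains a ball around p that is independent of
    w. A cut can increase the number of vertices, so vertices give no termination measure; cells of
    a fixed grid do. An unbounded primal program puts d only into the closure of T, hence K_I is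
    compared with cl T. The case n = 0 is degenerate: T may then be the whole line, and this is the
    only way in which the first program can be unbounded. *)

(** * Inner product, Euclidean norm and maximum norm *)

Section Dot.
Context {R : realType}.
Implicit Types (n : nat).

Lemma dotE n (u v : 'cV[R]_n) : dot u v = \sum_i u i 0 * v i 0.
Proof. by rewrite /dot mxE; apply: eq_bigr => i _; rewrite mxE. Qed.

Lemma dotC n (u v : 'cV[R]_n) : dot u v = dot v u.
Proof. by rewrite !dotE; apply: eq_bigr => i _; rewrite mulrC. Qed.

Lemma dotDr n (u v w : 'cV[R]_n) : dot u (v + w) = dot u v + dot u w.
Proof. by rewrite /dot mulmxDr mxE. Qed.

Lemma dotZr n a (u v : 'cV[R]_n) : dot u (a *: v) = a * dot u v.
Proof. by rewrite /dot -scalemxAr mxE. Qed.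

Lemma dotDl n (u v w : 'cV[R]_n) : dot (u + v) w = dot u w + dot v w.
Proof. by rewrite dotC dotDr !(dotC w). Qed.

Lemma dotZl n a (u v : 'cV[R]_n) : dot (a *: u) v = a * dot u v.
Proof. by rewrite dotC dotZr dotC. Qed.

Lemma dotNr n (u v : 'cV[R]_n) : dot u (- v) = - dot u v.
Proof. by rewrite -scaleN1r dotZr mulN1r. Qed.

Lemma dotNl n (u v : 'cV[R]_n) : dot (- u) v = - dot u v.
Proof. by rewrite dotC dotNr dotC. Qed.

Lemma dotBr n (u v w : 'cV[R]_n) : dot u (v - w) = dot u v - dot u w.
Proof. by rewrite dotDr dotNr. Qed.

Lemma dotBl n (u v w : 'cV[R]_n) : dot (u - v) w = dot u w - dot v w.
Proof. by rewrite dotDl dotNl. Qed.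

Lemma dot0r n (u : 'cV[R]_n) : dot u 0 = 0.
Proof. by rewrite /dot mulmx0 mxE. Qed.

Lemma dot_deltal n i (u : 'cV[R]_n) : dot (delta_mx i 0) u = u i 0.
Proof.
rewrite dotE (bigD1 i) //= mxE !eqxx mul1r big1 ?addr0 // => j ji.
by rewrite mxE (negPf ji) mul0r.
Qed.

Lemma dot_col_mx n m (u1 v1 : 'cV[R]_n) (u2 v2 : 'cV[R]_m) :
  dot (col_mx u1 u2) (col_mx v1 v2) = dot u1 v1 + dot u2 v2.
Proof. by rewrite /dot tr_col_mx mul_row_col mxE. Qed.

Lemma dot1_scalar (x y : R) : dot (x%:M : 'cV[R]_1) (y%:M) = x * y.
Proof. by rewrite dotE big_ord1 !mxE eqxx !mulr1n. Qed.

Lemma dot_ge0 n (u : 'cV[R]_n) : 0 <= dot u u.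
Proof. by rewrite dotE; apply: sumr_ge0 => i _; rewrite -expr2 sqr_ge0. Qed.

Lemma dot_eq0 n (u : 'cV[R]_n) : (dot u u == 0) = (u == 0).
Proof.
apply/eqP/eqP => [|->]; last by rewrite dot0r.
rewrite dotE => /psumr_eq0P H; apply/colP => i; rewrite mxE.
have /eqP := H (fun i _ => sqr_ge0 (u i 0)) i isT.
by rewrite mulf_eq0 orbb => /eqP.
Qed.

Lemma dot_gt0 n (u : 'cV[R]_n) : (0 < dot u u) = (u != 0).
Proof. by rewrite lt_def dot_ge0 andbT dot_eq0. Qed.

Lemma enorm_ge0 n (u : 'cV[R]_n) : 0 <= enorm u.
Proof. exact: sqrtr_ge0. Qed.

Lemma sqr_enorm n (u : 'cV[R]_n) : enorm u ^+ 2 = dot u u.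
Proof. by rewrite sqr_sqrtr ?dot_ge0. Qed.

Lemma enorm_eq0 n (u : 'cV[R]_n) : (enorm u == 0) = (u == 0).
Proof. by rewrite -dot_eq0 -sqr_enorm sqrf_eq0. Qed.

Lemma enorm0 n : enorm (0 : 'cV[R]_n) = 0.
Proof. by apply/eqP; rewrite enorm_eq0. Qed.

Lemma enorm_gt0 n (u : 'cV[R]_n) : (0 < enorm u) = (u != 0).
Proof. by rewrite lt_def enorm_ge0 andbT enorm_eq0. Qed.

Lemma enormZ n a (u : 'cV[R]_n) : enorm (a *: u) = `|a| * enorm u.
Proof.
by rewrite /enorm dotZl dotZr mulrA -expr2 sqrtrM ?sqr_ge0 // sqrtr_sqr.
Qed.

Lemma cauchy_schwarz n (u v : 'cV[R]_n) : dot u v <= enorm u * enorm v.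
Proof.
have [->|u0] := eqVneq u 0.
  by rewrite dotC dot0r mulr_ge0 ?enorm_ge0.
have [->|v0] := eqVneq v 0.
  by rewrite dot0r mulr_ge0 ?enorm_ge0.
have a0 : 0 < enorm u by rewrite enorm_gt0.
have b0 : 0 < enorm v by rewrite enorm_gt0.
(* With a and b the norms of u and v, this square equals 2ab(ab - u.v). *)
have := dot_ge0 (enorm v *: u - enorm u *: v).
rewrite dotBl !dotBr !dotZl !dotZr -!sqr_enorm (dotC v u).
rewrite [X in 0 <= X](_ : _ =
  2 * (enorm u * enorm v) * (enorm u * enorm v - dot u v)); last by ring.
rewrite pmulr_rge0 ?subr_ge0 //; apply: mulr_gt0 => //; exact: mulr_gt0.
Qed.

Lemma enormD n (u v : 'cV[R]_n) : enorm (u + v) <= enorm u + enorm v.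
Proof.
rewrite -(@ler_pXn2r _ 2) ?nnegrE ?enorm_ge0 ?addr_ge0 ?enorm_ge0 //.
rewrite sqr_enorm dotDl !dotDr (dotC v u) sqrrD !sqr_enorm.
by have := cauchy_schwarz u v; lra.
Qed.

Lemma normr_coord_le n (x : 'cV[R]_n) i : `|x i 0| <= `|x|.
Proof.
by rewrite [leRHS]/Num.Def.normr /= mx_normrE; apply/bigmax_geP; right => /=; exists (i, 0).
Qed.

Lemma normr_le_coord n (x : 'cV[R]_n) a :
  0 <= a -> (forall i, `|x i 0| <= a) -> `|x| <= a.
Proof.
move=> a0 xa; rewrite /Num.Def.normr /= mx_normrE; apply/bigmax_leP; split=> // -[i j] _.
by rewrite /= (ord1 j).
Qed.

Lemma normr_le_enorm n (x : 'cV[R]_n) : `|x| <= enorm x.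
Proof.
apply: normr_le_coord => [|i]; first exact: enorm_ge0.
rewrite -(@ler_pXn2r _ 2) ?nnegrE ?enorm_ge0 // sqr_enorm real_normK ?num_real //.
rewrite dotE (bigD1 i) //= expr2 lerDl; apply: sumr_ge0 => j _.
by rewrite -expr2 sqr_ge0.
Qed.

Lemma normr_dot_le n (u v : 'cV[R]_n) : `|dot u v| <= (\sum_i `|u i 0|) * `|v|.
Proof.
rewrite dotE (le_trans (ler_norm_sum _ _ _)) // mulr_suml; apply: ler_sum => i _.
by rewrite normrM ler_wpM2l // normr_coord_le.
Qed.

(** The sharp factor is the square root of n; the cruder n + 1 avoids roots and stays positive for n
    = 0. *)
Lemma enorm_le_normr n (x : 'cV[R]_n) : enorm x <= n.+1%:R * `|x|.
Proof.
rewrite -(@ler_pXn2r _ 2) ?nnegrE ?enorm_ge0 ?mulr_ge0 // sqr_enorm dotE.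
apply: (@le_trans _ _ (\sum_(i < n) `|x| ^+ 2)).
  apply: ler_sum => i _; rewrite -expr2 -real_normK ?num_real //.
  by rewrite lerXn2r ?nnegrE // normr_coord_le.
rewrite sumr_const card_ord exprMn -[leLHS]mulr_natl ler_wpM2r ?sqr_ge0 //.
by rewrite -natrX ler_nat (leq_trans (leqnSn n)) // leq_pmulr.
Qed.

End Dot.

(** * Closures and convex cones *)

Section Cones.
Context {R : realType}.

Lemma closure_normP (V : normedModType R) (A : set V) (x : V) :
  closure A x <-> forall e, 0 < e -> exists2 y, A y & `|x - y| < e.
Proof.
split=> [Ax e e0|H B /nbhs_normP[e /= e0 eB]].
  have [|y [Ay]] := Ax (ball x e); first exact: nbhsx_ballx.
  by rewrite -ball_normE; exists y.
by have [y Ay xy] := H e e0; exists y; split=> //; exact: eB.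
Qed.

Variable n : nat.
Implicit Types (K M : set 'cV[R]_n) (x y d : 'cV[R]_n).

Lemma convex_cone_cone M : convex_cone (cone M).
Proof.
split=> [K [[]]//|x y Mx My K KM|a x a0 Mx K KM].
  by case: (KM) => -[_ KD _] _; apply: KD; [exact: Mx|exact: My].
by case: (KM) => -[_ _ KZ] _; apply: KZ => //; exact: Mx.
Qed.

Lemma sub_cone M : M `<=` cone M.
Proof. by move=> x Mx K [_]; apply. Qed.

Lemma cone_sub M K : convex_cone K -> M `<=` K -> cone M `<=` K.
Proof. by move=> cK MK x; apply. Qed.

Lemma closure_convex_cone K : convex_cone K -> convex_cone (closure K).
Proof.
move=> [K0 KD KZ]; split.
- exact: subset_closure.
- move=> x y /closure_normP Kx /closure_normP Ky; apply/closure_normP => e e0.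
  have [x' Kx' xx'] := Kx (e / 2) ltac:(lra).
  have [y' Ky' yy'] := Ky (e / 2) ltac:(lra).
  exists (x' + y'); first exact: KD.
  have -> : x + y - (x' + y') = (x - x') + (y - y') by rewrite opprD addrACA.
  by rewrite (le_lt_trans (ler_normD _ _)) // (splitr e) ltrD.
- move=> a x a0 /closure_normP Kx; apply/closure_normP => e e0.
  (* Dividing by a + 1 rather than by a covers a = 0. *)
  have a1 : 0 < a + 1 by lra.
  have [x' Kx' xx'] := Kx (e / (a + 1)) (divr_gt0 e0 a1).
  exists (a *: x'); first exact: KZ.
  rewrite -scalerBr normrZ ger0_norm //.
  rewrite ltr_pdivlMr // in xx'; apply: le_lt_trans xx'.
  by rewrite mulrC ler_wpM2l // lerDl.
Qed.

(** This presents the enlarged cone as a projection along the scalar t, the form in which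
    [pcone_addray] can eliminate t. *)
Lemma cone_setU1 K d : convex_cone K ->
  cone (K `|` [set d]) = [set x | exists2 t, 0 <= t & K (x - t *: d)].
Proof.
move=> [K0 KD KZ]; apply/seteqP; split.
  apply: cone_sub => [|x [Kx|->]]; last 2 first.
  - by exists 0; rewrite // scale0r subr0.
  - by exists 1; rewrite // scale1r subrr.
  split=> [|x y [s s0 Ks] [t t0 Kt]|a x a0 [s s0 Ks]].
  - by exists 0; rewrite // scale0r subr0.
  - exists (s + t); first exact: addr_ge0.
    by rewrite scalerDl opprD addrACA; exact: KD.
  - exists (a * s); first exact: mulr_ge0.
    by rewrite -scalerA -scalerBr; exact: KZ.
move=> x [t t0 Kt]; rewrite -(subrK (t *: d) x).
have [_ cD cZ] := convex_cone_cone (K `|` [set d]).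
by apply: cD; [|apply: cZ => //]; apply: sub_cone; [left|right].
Qed.

Lemma cone_set1 d : cone [set d] = [set x | exists2 t, 0 <= t & x = t *: d].
Proof.
apply/seteqP; split.
  apply: cone_sub => [|x ->]; last by exists 1; rewrite ?scale1r.
  split=> [|x y [s s0 ->] [t t0 ->]|a x a0 [s s0 ->]].
  - by exists 0; rewrite ?scale0r.
  - by exists (s + t); rewrite ?scalerDl ?addr_ge0.
  - by exists (a * s); rewrite ?scalerA ?mulr_ge0.
move=> x [t t0 ->]; have [_ _ cZ] := convex_cone_cone [set d].
by apply: cZ => //; exact: sub_cone.
Qed.

Lemma closed_halfspace (w : 'cV[R]_n) g : closed (halfspace w g).
Proof.
rewrite closure_id; apply/seteqP; split; first exact: subset_closure.
move=> x /closure_normP Hx; rewrite /halfspace /= leNgt; apply/negP => gx.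
set C := \sum_i `|w i 0|; have C0 : 0 <= C by exact: sumr_ge0.
have [|y wy xy] := Hx ((dot w x - g) / (C + 1)).
  by apply: divr_gt0; rewrite ?subr_gt0 // ltr_wpDl.
have := normr_dot_le w (x - y); rewrite dotBr -/C => H.
have C1 : 0 < C + 1 by rewrite ltr_wpDl.
rewrite ltr_pdivlMr // in xy.
have {}H := le_trans (ler_norm _) H; have := normr_ge0 (x - y).
move: wy; rewrite /halfspace /= => wy xy0.
by rewrite mulrDr mulr1 [X in X + _]mulrC in xy; lra.
Qed.

End Cones.

(** * Polyhedral cones and polytopes *)

Section Polyhedra.
Context {R : realType}.

(** Serves two ratio tests: the tightest lower bound in Fourier-Motzkin elimination, and the first
    constraint met along a direction. *)
Lemma seq_argmin (T : eqType) (s : seq T) (p : pred T) (f : T -> R) :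
  has p s -> exists2 x, x \in s & p x /\ {in s, forall y, p y -> f x <= f y}.
Proof.
elim: s => [//|a s IH] /=.
have [hs _|/hasPn hs] := boolP (has p s); last first.
  rewrite orbF => pa; exists a; rewrite ?mem_head //; split=> // y.
  by rewrite in_cons => /predU1P[->//|/hs /negP py /py].
have [x xs [px xmin]] := IH hs.
have [pa|pa] := boolP (p a); last first.
  exists x; first by rewrite in_cons xs orbT.
  split=> // y; rewrite in_cons => /predU1P[->|]; last exact: xmin.
  by rewrite (negPf pa).
have [ax|xa] := lerP (f a) (f x).
  exists a; rewrite ?mem_head //; split=> // y.
  by rewrite in_cons => /predU1P[->//|ys py]; exact: le_trans ax (xmin y ys py).
exists x; first by rewrite in_cons xs orbT.
by split=> // y; rewrite in_cons => /predU1P[->|]; [rewrite ltW|exact: xmin].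
Qed.

Variable n : nat.
Implicit Types (x y d v : 'cV[R]_n) (K : set 'cV[R]_n).

(** Both cones of the algorithm are kept in this form: a cut adds a normal, and a new generator is
    absorbed by elimination. Closedness, polyhedral slices and finitely many box vertices then
    follow uniformly. *)
Definition pcone (hs : seq 'cV[R]_n) : set 'cV[R]_n :=
  [set x | {in hs, forall h, dot h x <= 0}].

Lemma convex_cone_pcone hs : convex_cone (pcone hs).
Proof.
split=> [h _|x y Hx Hy h hh|a x a0 Hx h hh].
- by rewrite dot0r.
- by rewrite dotDr; have := Hx h hh; have := Hy h hh; lra.
- by rewrite dotZr mulr_ge0_le0 // Hx.
Qed.

Lemma pcone1 w : halfspace w 0 = pcone [:: w].
Proof.
apply/seteqP; split=> x /=; last by apply; rewrite mem_head.
by move=> wx h; rewrite inE => /eqP ->.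
Qed.

Lemma pcone_cons w hs : pcone hs `&` halfspace w 0 = pcone (w :: hs).
Proof.
apply/seteqP; split=> x /=.
  by move=> [Hx wx] h; rewrite inE => /predU1P[->|]; [|exact: Hx].
by move=> Hx; split=> [h hh|]; apply: Hx; rewrite inE ?hh ?orbT ?eqxx.
Qed.

Lemma pcone_set0 : exists hs, pcone hs = [set 0].
Proof.
exists ([seq delta_mx i 0 | i <- enum 'I_n] ++ [seq - delta_mx i 0 | i <- enum 'I_n]).
apply/seteqP; split=> [x Hx|x ->]; last by move=> h _; rewrite dot0r.
apply/colP => i; rewrite mxE; apply/eqP; rewrite eq_le.
have := Hx (delta_mx i 0); have := Hx (- delta_mx i 0).
rewrite dotNl dot_deltal !mem_cat oppr_le0 => -> //; last first.
  by rewrite (map_f (fun i => - delta_mx i 0)) ?mem_enum ?orbT.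
by move=> -> //; rewrite (map_f (fun i => delta_mx i 0)) ?mem_enum.
Qed.

(* Fourier-Motzkin elimination of t. *)
Lemma pcone_addray hs d :
  exists hs', pcone hs' = [set x | exists2 t, 0 <= t & pcone hs (x - t *: d)].
Proof.
exists ([seq h <- hs | dot h d <= 0] ++
  [seq dot h d *: g - dot g d *: h | h <- [seq h <- hs | 0 < dot h d],
                                     g <- [seq g <- hs | dot g d < 0]]).
apply/seteqP; split=> x /=; last first.
  move=> [t t0 Hx] u; rewrite mem_cat => /orP[|/allpairsP[[h g] /=]].
    rewrite mem_filter => /andP[ud uh]; have := Hx u uh.
    by rewrite dotBr dotZr; nra.
  rewrite !mem_filter => -[/andP[hd hh] /andP[gd hg] ->].
  have := Hx h hh; have := Hx g hg.
  by rewrite !dotBr !dotZr dotBl !dotZl; nra.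
move=> Hx.
have Hneg h : h \in hs -> dot h d <= 0 -> dot h x <= 0.
  by move=> hh hd; apply: Hx; rewrite mem_cat mem_filter hd hh.
have Hmix h g : h \in hs -> g \in hs -> 0 < dot h d -> dot g d < 0 ->
    dot h d * dot g x <= dot g d * dot h x.
  move=> hh hg hd gd; rewrite -subr_le0 -!dotZl -dotBl; apply: Hx.
  rewrite mem_cat; apply/orP; right; apply/allpairsP; exists (h, g) => /=.
  by rewrite !mem_filter hd gd hh hg.
have [hpos|/hasPn hpos] := boolP (has (fun h => 0 < dot h d) hs); last first.
  exists 0; rewrite // scale0r subr0 => h hh; apply: Hneg => //.
  by rewrite leNgt hpos.
(* A constraint with [dot h d > 0] bounds t from below by [dot h x / dot h d]. The largest such
   bound serves as t, or 0 if it is not positive. *)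
have [h hh [hd hmax]] := seq_argmin (fun h => - (dot h x / dot h d)) hpos.
have {}hmax g : g \in hs -> 0 < dot g d -> dot g x <= dot h x / dot h d * dot g d.
  by move=> hg gd; rewrite -ler_pdivrMr //; have := hmax g hg gd; rewrite lerN2.
have [t0|t0] := lerP (dot h x / dot h d) 0.
  exists 0; rewrite // scale0r subr0 => g hg.
  have [gd|gd] := lerP (dot g d) 0; first exact: Hneg.
  by apply: le_trans (hmax g hg gd) _; rewrite mulr_le0_ge0 // ltW.
exists (dot h x / dot h d); first exact: ltW.
move=> g hg; rewrite dotBr dotZr subr_le0.
have [gd|gd|gd] := ltrgtP (dot g d) 0; last by rewrite gd mulr0 Hneg // gd.
  by rewrite mulrAC ler_pdivlMr // mulrC [leRHS]mulrC Hmix.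
exact: hmax.
Qed.

Lemma pcone_cone_setU1 hs d : exists hs', cone (pcone hs `|` [set d]) = pcone hs'.
Proof.
have [hs' E] := pcone_addray hs d; exists hs'.
by rewrite E cone_setU1 //; exact: convex_cone_pcone.
Qed.

Lemma pcone_cone_set1 d : exists hs, cone [set d] = pcone hs.
Proof.
have [hs E0] := pcone_set0; have [hs' E] := pcone_addray hs d.
exists hs'; rewrite E E0 cone_set1; apply/seteqP; split=> x [t t0].
  by move=> ->; exists t; rewrite //= subrr.
by move=> /eqP; rewrite subr_eq0 => /eqP ->; exists t.
Qed.

Lemma closed_pcone hs : closed (pcone hs).
Proof.
rewrite closure_id; apply/seteqP; split; first exact: subset_closure.
move=> x Hx h hh; have := @closed_halfspace R n h 0; rewrite closure_id => E.
change (halfspace h 0 x); rewrite E; apply: closureS Hx => y Hy; exact: Hy.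
Qed.

(** * Vertices of a polytope and its tight constraints *)

Section Polytope.
Variable hs : seq ('cV[R]_n * R).
Let P : set 'cV[R]_n := [set x | {in hs, forall h, dot h.1 x <= h.2}].

Let tight x (h : 'cV[R]_n * R) := dot h.1 x == h.2.

Lemma tight_lt x h : P x -> h \in hs -> ~~ tight x h -> dot h.1 x < h.2.
Proof. by move=> Px hh; rewrite /tight lt_neqAle => ->; rewrite Px. Qed.

(** Move along v up to the first blocking constraint. It becomes tight, and the constraints tight at
    x stay so because their normals are orthogonal to v. *)
Lemma polytope_push x v : P x ->
  {in hs, forall h, tight x h -> dot h.1 v = 0} ->
  has (fun h => 0 < dot h.1 v) hs ->
  exists2 s, 0 < s & P (x + s *: v) /\
    (count (fun h => ~~ tight (x + s *: v) h) hs <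
     count (fun h => ~~ tight x h) hs)%N.
Proof.
move=> Px tv hv.
have [h hh [hv0 hmin]] :=
  seq_argmin (fun h => (h.2 - dot h.1 x) / dot h.1 v) hv.
set s := _ / _ in hmin.
have nth : ~~ tight x h by apply/negP => /tv E; rewrite E // ltxx in hv0.
have s0 : 0 < s by rewrite divr_gt0 // subr_gt0; exact: tight_lt.
have tth : tight (x + s *: v) h.
  by rewrite /tight dotDr dotZr /s divfK ?lt0r_neq0 // addrC subrK.
exists s; [exact: s0|split=> [g hg|]].
  rewrite dotDr dotZr -lerBrDl; have [gv|gv] := ltrP 0 (dot g.1 v).
    by rewrite -ler_pdivlMr // hmin.
  by apply: (@le_trans _ _ 0); [rewrite mulr_ge0_le0 // ltW|rewrite subr_ge0 Px].
have sub g : g \in hs -> tight x g -> tight (x + s *: v) g.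
  by move=> hg xg; rewrite /tight dotDr dotZr tv // mulr0 addr0.
rewrite -!size_filter; have -> : [seq g <- hs | ~~ tight (x + s *: v) g] =
    [seq g <- [seq g <- hs | ~~ tight x g] | ~~ tight (x + s *: v) g].
  rewrite -filter_predI; apply: eq_in_filter => g hg /=.
  by have [xg|_] := boolP (tight x g); rewrite ?andbT // sub.
rewrite size_filter ltn_neqAle count_size andbT -all_count.
apply/allPn; exists h; by rewrite ?mem_filter ?nth //= tth.
Qed.

Lemma polytope_ray x v M : v != 0 -> P x -> (forall y, P y -> `|y| <= M) ->
  has (fun h => 0 < dot h.1 v) hs.
Proof.
move=> v0 Px PM; apply: contraT => /hasPn hv.
have v0' : 0 < `|v| by rewrite normr_gt0.
have M0 : 0 <= M by apply: le_trans (PM x Px).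
(* A displacement of norm 2M + 1 exceeds the distance 2M possible inside P. *)
pose s := (2 * M + 1) / `|v|.
have s0 : 0 < s by apply: divr_gt0 => //; lra.
have Py : P (x + s *: v).
  move=> h hh; rewrite dotDr dotZr; have := Px h hh; have := hv h hh.
  by rewrite -leNgt; nra.
have := ler_normB (x + s *: v) x; rewrite addrAC subrr add0r normrZ.
rewrite (gtr0_norm s0) /s divfK ?gt_eqF //.
by have := PM _ Px; have := PM _ Py; lra.
Qed.

(** A constraint tight strictly between y and z is tight at both, so its normal is orthogonal to y -
    z. *)
Lemma nonvertex_dir x : P x -> ~ vert P x ->
  exists2 v, v != 0 & {in hs, forall h, tight x h -> dot h.1 v = 0}.
Proof.
move=> Px nv; apply: contrapT => nex; apply: nv; split=> // y z t Py Pz /andP[t0 t1] E.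
apply: contrapT => yz; apply: nex; exists (y - z).
  by rewrite subr_eq0; apply/eqP.
move=> h hh /eqP th; move: th; rewrite E [in X in X -> _]dotDr !dotZr dotBr => th.
have zh := Pz h hh; have yh := Py h hh.
have H : t * (h.2 - dot h.1 y) + (1 - t) * (h.2 - dot h.1 z) = 0 by rewrite -th; ring.
have H1 : 0 <= t * (h.2 - dot h.1 y) by apply: mulr_ge0; lra.
have H2 : 0 <= (1 - t) * (h.2 - dot h.1 z) by apply: mulr_ge0; lra.
have /eqP : t * (h.2 - dot h.1 y) = 0 by lra.
have /eqP : (1 - t) * (h.2 - dot h.1 z) = 0 by lra.
rewrite !mulf_eq0 => /orP[/eqP|/eqP] H3 /orP[/eqP|/eqP] H4; lra.
Qed.

(* Krein-Milman, by induction on the number of constraints that are not tight: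
   a point that is not a vertex lies between two points with fewer of them. *)
Lemma polytope_ind (Q : set 'cV[R]_n) M :
  (forall y, P y -> `|y| <= M) ->
  (forall y z t, 0 <= t <= 1 -> Q y -> Q z -> Q (t *: y + (1 - t) *: z)) ->
  vert P `<=` Q -> P `<=` Q.
Proof.
move=> PM cQ vQ x; have [k] := ubnP (count (fun h => ~~ tight x h) hs).
elim: k x => [//|k IH] x kx Px.
have [/vQ //|nv] := pselect (vert P x).
have [v v0 tv] := nonvertex_dir Px nv.
have tv' : {in hs, forall h, tight x h -> dot h.1 (- v) = 0}.
  by move=> h hh th; rewrite dotNr tv // oppr0.
have Nv0 : - v != 0 by rewrite oppr_eq0.
have [s s0 [Py cy]] := polytope_push Px tv (polytope_ray v0 Px PM).
have [t t0 [Pz cz]] := polytope_push Px tv' (polytope_ray Nv0 Px PM).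
have st : 0 < s + t by lra.
have Qy := IH _ (leq_trans cy (kx : (_ <= k)%N)) Py.
have Qz := IH _ (leq_trans cz (kx : (_ <= k)%N)) Pz.
(* These weights make the opposite displacements s v and - t v cancel. *)
suff -> : x = (t / (s + t)) *: (x + s *: v) + (1 - t / (s + t)) *: (x + t *: - v).
  apply: cQ => //; rewrite divr_ge0 ?(ltW t0, ltW st) //= ler_pdivrMr // mul1r; lra.
have -> : 1 - t / (s + t) = s / (s + t) by field; rewrite gt_eqF.
apply/colP => i; rewrite !mxE; field; by rewrite gt_eqF.
Qed.

(** If x and y differed, the segment from y to x could be prolonged a little beyond x inside P, as
    the constraints tight at x are constant along it; x would then not be extreme. *)
Lemma vertex_unique x y : vert P x -> P y ->
  {in hs, forall h, tight x h = tight y h} -> x = y.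
Proof.
move=> [Px vx] Py txy; apply/eqP; rewrite -subr_eq0; apply: contraT => v0.
have tv : {in hs, forall h, tight x h -> dot h.1 (x - y) = 0}.
  move=> h hh th; move: (th); rewrite txy // => /eqP th'; move/eqP: th => th.
  by rewrite dotBr th th' subrr.
have [s s0 Ps] : exists2 s, 0 < s & P (x + s *: (x - y)).
  have [hv|/hasPn hv] := boolP (has (fun h => 0 < dot h.1 (x - y)) hs).
    by have [s s0 []] := polytope_push Px tv hv; exists s.
  exists 1 => // h hh; rewrite scale1r dotDr; have := hv h hh.
  by rewrite -leNgt; have := Px h hh; lra.
have s1 : 0 < 1 + s by lra.
have xsy : x + s *: (x - y) = y.
  apply: (vx _ _ (1 + s)^-1 Ps Py); first by rewrite invr_gt0 s1 invf_lt1 // ltrDl s0.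
  by apply/colP => i; rewrite !mxE; field; rewrite gt_eqF.
have /eqP : (1 + s) *: (x - y) = 0.
  by rewrite scalerDl scale1r addrAC xsy subrr.
by rewrite scaler_eq0 (gt_eqF s1) /= (negPf v0).
Qed.

(** By [vertex_unique] a vertex is determined by its pattern of tight constraints, and there are
    finitely many patterns. A pattern without a vertex yields the default 0, which the filter drops
    unless 0 is a vertex. *)
Lemma vert_finite : exists2 rs : seq 'cV[R]_n, uniq rs & forall r, r \in rs <-> vert P r.
Proof.
pose c x : (size hs).-tuple bool := map_tuple (tight x) (in_tuple hs).
pose rep b := xget 0 [set x | vert P x /\ c x = b].
exists [seq r <- undup [seq rep b | b <- enum {: (size hs).-tuple bool}]
           | `[< vert P r >]].
  by rewrite filter_uniq ?undup_uniq.
move=> r; rewrite mem_filter mem_undup; split=> [/andP[/asboolP]//|vr].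
apply/andP; split; first exact/asboolP.
apply/mapP; exists (c r); first by rewrite mem_enum.
rewrite /rep; case: xgetP => [y -> [vy cy]|/(_ r)]; last by case.
apply: vertex_unique => //; first by case: vy.
move=> h hh; have /(congr1 val)/= E := cy.
have := congr1 (fun s => nth false s (index h hs)) E.
by rewrite !(nth_map h) ?index_mem // nth_index.
Qed.

End Polytope.

Definition box_constraints : seq ('cV[R]_n * R) :=
  [seq (delta_mx i 0, 1) | i <- enum 'I_n] ++
  [seq (- delta_mx i 0, 1) | i <- enum 'I_n].

Lemma box_constraintsE x :
  {in box_constraints, forall h, dot h.1 x <= h.2} <-> `|x| <= 1.
Proof.
split=> [Hx|Hx h].
  apply: normr_le_coord => // i; rewrite ler_norml.
  have := Hx (delta_mx i 0, 1); have := Hx (- delta_mx i 0, 1).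
  rewrite /= dotNl dot_deltal lerNl !mem_cat => -> //; last first.
    by rewrite (map_f (fun i => (- delta_mx i 0, 1))) ?mem_enum ?orbT.
  by move=> -> //; rewrite (map_f (fun i => (delta_mx i 0, 1))) ?mem_enum.
rewrite mem_cat => /orP[]/mapP[i _ ->] /=; rewrite ?dotNl dot_deltal.
  by rewrite (le_trans (ler_norm _)) // (le_trans (normr_coord_le _ _)).
rewrite -normrN in Hx.
have := normr_coord_le (- x) i; rewrite mxE => H.
by rewrite (le_trans (ler_norm _)) // (le_trans H).
Qed.

Lemma pcone_boxE hs : pcone hs `&` [set x | `|x| <= 1] =
  [set x | {in [seq (h, 0) | h <- hs] ++ box_constraints,
              forall h, dot h.1 x <= h.2}].
Proof.
apply/seteqP; split=> x /=.
  move=> [Hx /box_constraintsE xb] h; rewrite mem_cat => /orP[/mapP[g gh ->]|].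
    exact: Hx.
  exact: xb.
move=> Hx; split=> [h hh|].
  by apply: (Hx (h, 0)); rewrite mem_cat (map_f (fun h => (h, 0))).
by apply/box_constraintsE => h hh; apply: Hx; rewrite mem_cat hh orbT.
Qed.

Lemma box_vertices_finite hs :
  exists2 rs, uniq rs & forall r, r \in rs <-> box_vertices (pcone hs) r.
Proof.
rewrite /box_vertices pcone_boxE; set hs' := _ ++ _.
have [rs urs rsP] := vert_finite hs'.
exists [seq r <- rs | r != 0]; first exact: filter_uniq.
move=> r; rewrite mem_filter; split; first by move=> /andP[? /rsP].
by move=> [/rsP ? ?]; apply/andP.
Qed.

(** [box_vertices] leaves out the origin, hence the separate hypothesis [Q 0]. *)
Lemma box_ind hs (Q : set 'cV[R]_n) :
  (forall y z t, 0 <= t <= 1 -> Q y -> Q z -> Q (t *: y + (1 - t) *: z)) ->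
  Q 0 -> box_vertices (pcone hs) `<=` Q ->
  forall x, pcone hs x -> `|x| <= 1 -> Q x.
Proof.
move=> cQ Q0 vQ x Kx x1.
have: (pcone hs `&` [set x | `|x| <= 1]) x by [].
rewrite pcone_boxE; apply: polytope_ind => //.
  by rewrite -pcone_boxE => y [_]; exact: id.
rewrite -pcone_boxE => r vr; have [->//|r0] := eqVneq r 0.
exact: vQ.
Qed.

End Polyhedra.

(** * Semidefinite duality *)

Section Separation.
Context {R : realType}.

(** Row vectors are the form in which compactness is applied below and in which [mxvec] presents a
    matrix. *)
Lemma rV_quadratic_continuous k (X : 'M[R]_k) :
  continuous (fun u : 'rV[R]_k => dot u^T (X *m u^T)).
Proof.
have -> : (fun u : 'rV[R]_k => dot u^T (X *m u^T)) =
    fun u => \sum_i u 0 i * (\sum_j X i j * u 0 j).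
  apply/funext => u; rewrite dotE; apply: eq_bigr => i _.
  by rewrite !mxE; congr (_ * _); apply: eq_bigr => j _; rewrite mxE.
apply: continuous_big => [|i _ u]; first exact: add_continuous.
apply: continuousM; first exact: (@coord_continuous R 1 k 0 i u).
move: u; apply: continuous_big => [|j _ u]; first exact: add_continuous.
by apply: continuousM; [exact: cst_continuous|exact: (@coord_continuous R 1 k 0 j u)].
Qed.

Lemma bounded_closed_min k (f : 'rV[R]_k -> R) (A : set 'rV[R]_k) M :
  continuous f -> closed A -> (forall x, A x -> `|x| <= M) -> A !=set0 ->
  exists2 v, A v & forall x, A x -> f v <= f x.
Proof.
move=> cf cA bA A0.
have kA : compact A.
  apply: bounded_closed_compact => //; exists M; split; first exact: num_real.
  by move=> b Mb x Ax /=; rewrite (le_trans (bA x Ax)) // ltW.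
have [v vA vmin] := compact_EVT_min A0 kA (continuous_subspaceT cf).
exists v; first by rewrite inE in vA.
by move=> x Ax; apply: vmin; rewrite inE.
Qed.

Lemma closed_normr_le (V : normedModType R) (M : R) : closed [set x : V | `|x| <= M].
Proof.
have -> : [set x : V | `|x| <= M] = (fun x => `|x|) @^-1` [set y | y <= M] by [].
by apply: preimage_closed; [move=> x _; exact: norm_continuous|exact: closed_le].
Qed.

Lemma normr_tr k (u : 'rV[R]_k) : `|u^T| = `|u|.
Proof.
apply/eqP; rewrite eq_le; apply/andP; split.
  apply: normr_le_coord => // i; rewrite mxE [leRHS]/Num.Def.normr /= mx_normrE.
  by apply/bigmax_geP; right => /=; exists (0, i).
rewrite [leLHS]/Num.Def.normr /= mx_normrE; apply/bigmax_leP; split=> // -[i j] _ /=.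
by rewrite (ord1 i); have := normr_coord_le u^T j; rewrite mxE.
Qed.

(* The point of the closure of Z nearest to the origin separates. *)
Lemma separation0 k (Z : set 'rV[R]_k) c :
  (forall x y t, 0 <= t <= 1 -> Z x -> Z y -> Z ((1 - t) *: x + t *: y)) ->
  Z !=set0 -> 0 < c -> (forall z, Z z -> c <= `|z|) ->
  exists v, forall z, Z z -> 0 < dot v^T z^T.
Proof.
move=> cZ [z0 Zz0] c0 Zc.
pose f (u : 'rV[R]_k) := dot u^T u^T.
have fq : f = fun u : 'rV[R]_k => dot u^T (1%:M *m u^T).
  by apply/funext => u; rewrite mul1mx.
have f_norm u : `|u| ^+ 2 <= f u.
  rewrite /f -sqr_enorm lerXn2r ?nnegrE ?enorm_ge0 // -normr_tr.
  exact: normr_le_enorm.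
(* Outside the ball of radius M, f exceeds [f z0], so the minimum over the compact part is a minimum
   over the whole closure. *)
pose M := 1 + f z0.
have f0 : 0 <= f z0 by exact: dot_ge0.
have [||x []//||v [clv vM] vmin] :=
    @bounded_closed_min k f (closure Z `&` [set x | `|x| <= M]) M.
- by rewrite fq; exact: rV_quadratic_continuous.
- apply: closedI; [exact: closed_closure|exact: closed_normr_le].
- exists z0; split; first exact: subset_closure.
  by rewrite /= /M; have := f_norm z0; have := normr_ge0 z0; nra.
have {}vmin x : closure Z x -> f v <= f x.
  move=> clx; have [xM|Mx] := lerP `|x| M; first exact: vmin.
  apply: (@le_trans _ _ (f z0)).
    apply: vmin; split; first exact: subset_closure.
    by rewrite /= /M; have := f_norm z0; have := normr_ge0 z0; nra.
  by have := f_norm x; rewrite /M in Mx; nra.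
have v0 : 0 < f v.
  rewrite /f dot_gt0; apply/eqP => vT0.
  have /closure_normP/(_ c c0)[y Zy] := clv.
  have -> : v = 0 by rewrite -[v]trmxK vT0 trmx0.
  by rewrite sub0r normrN ltNge Zc.
exists v => z Zz; set b := dot v^T z^T.
have H t : 0 <= t <= 1 ->
    f v <= (1 - t) ^+ 2 * f v + 2 * t * (1 - t) * b + t ^+ 2 * f z.
  move=> t01; have /andP[t0 t1] := t01.
  have -> : (1 - t) ^+ 2 * f v + 2 * t * (1 - t) * b + t ^+ 2 * f z =
      f ((1 - t) *: v + t *: z).
    rewrite /f /b !linearD !linearZ /= dotDl !dotDr !dotZl !dotZr (dotC z^T v^T).
    by ring.
  apply: vmin; apply/closure_normP => e e0.
  have /closure_normP/(_ e e0)[y Zy vy] := clv.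
  exists ((1 - t) *: y + t *: z); first exact: cZ.
  rewrite opprD addrACA subrr addr0 -scalerBr normrZ ger0_norm; last by lra.
  by apply: le_lt_trans vy; rewrite ler_piMl //; lra.
rewrite ltNge; apply/negP => b0.
have fz : 0 <= f z by exact: dot_ge0.
have D0 : 0 < f v + f z + 1 by lra.
(* If b <= 0, then H implies 2 f v <= t (f v + f z). For this t the right side is f v - t, which is
   too small. *)
have [t [t0 t1 tD]] : exists t, [/\ 0 < t, t <= 1 & t * (f v + f z + 1) = f v].
  exists (f v / (f v + f z + 1)).
  by rewrite divr_gt0 // divfK ?gt_eqF // ler_pdivrMr //; split=> //; lra.
have /H : 0 <= t <= 1 by rewrite (ltW t0) t1.
have : 2 * t * (1 - t) * b <= 0.
  by rewrite mulr_ge0_le0 // mulr_ge0 ?mulr_ge0 ?(ltW t0) //; lra.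
have : t * (t * (f v + f z + 1)) = t * f v by rewrite tD.
have : 0 < t * f v by exact: mulr_gt0.
have : 0 < t * t by exact: mulr_gt0.
by rewrite !expr2; nra.
Qed.

End Separation.

(** * Positive semidefinite and positive definite matrices *)

Section Semidefinite.
Context {R : realType}.
Implicit Types (l : nat).

Lemma psd0 l : psd (0 : 'M[R]_l).
Proof. by split=> [|v]; rewrite ?trmx0 // mul0mx dot0r. Qed.

Lemma psdD l (X Y : 'M[R]_l) : psd X -> psd Y -> psd (X + Y).
Proof.
move=> [Xs X0] [Ys Y0]; split=> [|v]; first by rewrite linearD /= Xs Ys.
by rewrite mulmxDl dotDr addr_ge0.
Qed.

Lemma psdZ l a (X : 'M[R]_l) : 0 <= a -> psd X -> psd (a *: X).
Proof.
move=> a0 [Xs X0]; split=> [|v]; first by rewrite linearZ /= Xs.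
by rewrite -scalemxAl dotZr mulr_ge0.
Qed.

Lemma pd_psd l (X : 'M[R]_l) : pd X -> psd X.
Proof.
move=> [Xs X0]; split=> // v; have [->|/X0/ltW //] := eqVneq v 0.
by rewrite mulmx0 dot0r.
Qed.

Lemma pdD l (X Y : 'M[R]_l) : pd X -> psd Y -> pd (X + Y).
Proof.
move=> [Xs X0] [Ys Y0]; split=> [|v v0]; first by rewrite linearD /= Xs Ys.
by rewrite mulmxDl dotDr ltr_pwDl // X0.
Qed.

(** By homogeneity, a can be the minimum of the quadratic form on the unit sphere of the maximum
    norm, attained by compactness. That sphere is empty for l = 0, hence the case split. *)
Lemma pd_coercive l (X : 'M[R]_l) : pd X ->
  exists2 a, 0 < a & forall v, a * `|v| ^+ 2 <= dot v (X *m v).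
Proof.
move=> [Xs X0].
pose A := [set u : 'rV[R]_l | `|u| = 1].
have normalize (v : 'cV[R]_l) : v != 0 -> A (`|v|^-1 *: v^T).
  move=> v0; have v0' : 0 < `|v| by rewrite normr_gt0.
  by rewrite /A /= normrZ -normr_tr trmxK normfV normr_id mulVf ?gt_eqF.
have [A0|nA] := pselect (A !=set0); last first.
  exists 1 => // v; have [->|/normalize Av] := eqVneq v 0; last first.
    by case: nA; exists (`|v|^-1 *: v^T).
  by rewrite mulmx0 dot0r normr0 expr0n mulr0.
have cA : closed A.
  have -> : A = (fun x : 'rV[R]_l => `|x|) @^-1` [set 1] by [].
  by apply: preimage_closed; [move=> x _; exact: norm_continuous|exact: closed_eq].
have bA x : A x -> `|x| <= 1 by move=> ->.
have [u u1 umin] := bounded_closed_min (@rV_quadratic_continuous R l X) cA bA A0.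
exists (dot u^T (X *m u^T)).
  by apply: X0; apply/eqP => u0; move: u1; rewrite /A /= -normr_tr u0 normr0; lra.
move=> v; have [->|v0] := eqVneq v 0.
  by rewrite mulmx0 dot0r normr0 expr0n mulr0.
have v0' : 0 < `|v| by rewrite normr_gt0.
have := umin _ (normalize v v0); rewrite linearZ /= trmxK -scalemxAr dotZl dotZr.
by rewrite mulrA -invfM -expr2 ler_pdivlMl ?exprn_gt0 // mulrC.
Qed.

Lemma pd_open l (X : 'M[R]_l) : pd X ->
  exists2 e, 0 < e & forall Y : 'M[R]_l,
    Y^T = Y -> (forall i j, `|Y i j| <= e) -> pd (X + Y).
Proof.
move=> pX; have [a a0 Xa] := pd_coercive pX; have [Xs _] := pX.
have L0 : 0 < (l.+1%:R : R) ^+ 2 by rewrite exprn_gt0.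
(* The form of Y has l^2 terms, each at most this bound times the squared norm of v, so it uses up
   at most half of the coercivity constant a. *)
exists (a / 2 / l.+1%:R ^+ 2); first by rewrite divr_gt0 // divr_gt0.
move=> Y Ys Ye; split=> [|v v0]; first by rewrite linearD /= Xs Ys.
have v0' : 0 < `|v| ^+ 2 by rewrite exprn_gt0 // normr_gt0.
have Yv : `|dot v (Y *m v)| <= a / 2 * `|v| ^+ 2.
  rewrite dotE; apply: le_trans (ler_norm_sum _ _ _) _.
  apply: (@le_trans _ _ (\sum_(i < l) \sum_(j < l) a / 2 / l.+1%:R ^+ 2 * `|v| ^+ 2)).
    apply: ler_sum => i _; rewrite mxE mulr_sumr.
    apply: le_trans (ler_norm_sum _ _ _) _; apply: ler_sum => j _.
    rewrite !normrM mulrCA expr2 ler_pM ?mulr_ge0 //.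
    by rewrite ler_pM ?normr_coord_le.
  rewrite !sumr_const !card_ord -mulrnA -[leLHS]mulr_natl.
  set q := a / 2 / _ * _.
  have q0 : 0 <= q by rewrite mulr_ge0 ?(ltW v0') // !divr_ge0 ?(ltW a0) ?(ltW L0).
  have -> : a / 2 * `|v| ^+ 2 = l.+1%:R ^+ 2 * q by rewrite /q; field; rewrite gt_eqF.
  by rewrite ler_wpM2r // -natrX ler_nat mulnn leq_sqr.
rewrite mulmxDl dotDr; have := Xa v; move: Yv; rewrite ler_norml => /andP[].
by nra.
Qed.

Lemma pd_open_line l (X Y : 'M[R]_l) : pd X -> Y^T = Y ->
  exists2 e, 0 < e & forall s, `|s| <= e -> pd (X + s *: Y).
Proof.
move=> pX Ys; have [e e0 He] := pd_open pX.
pose M : R := 1 + \sum_i \sum_j `|Y i j|.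
have S0 : 0 <= \sum_i \sum_j `|Y i j|.
  by apply: sumr_ge0 => i _; apply: sumr_ge0.
have M0 : 0 < M by rewrite /M; lra.
exists (e / M); first exact: divr_gt0.
move=> s se; apply: He => [|i j]; first by rewrite linearZ /= Ys.
rewrite mxE normrM; apply: (@le_trans _ _ (e / M * M)); last by rewrite divfK ?gt_eqF.
rewrite ler_pM //.
have : `|Y i j| <= \sum_i \sum_j `|Y i j|.
  rewrite (bigD1 i) //= (bigD1 j) //= -addrA lerDl addr_ge0 // sumr_ge0 // => k _.
  exact: sumr_ge0.
by rewrite /M; lra.
Qed.

Lemma mxdotDl l (X Y V : 'M[R]_l) : mxdot (X + Y) V = mxdot X V + mxdot Y V.
Proof. by rewrite /mxdot mulmxDl mxtraceD. Qed.

Lemma mxdotZl l a (X V : 'M[R]_l) : mxdot (a *: X) V = a * mxdot X V.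
Proof. by rewrite /mxdot -scalemxAl mxtraceZ. Qed.

Lemma mxdotZr l a (X V : 'M[R]_l) : mxdot X (a *: V) = a * mxdot X V.
Proof. by rewrite /mxdot -scalemxAr mxtraceZ. Qed.

Lemma mxdot_linmap n l (A : 'I_n -> 'M[R]_l) x V :
  mxdot (linmap A x) V = dot x (adjoint A V).
Proof.
rewrite /linmap /mxdot mulmx_suml raddf_sum dotE; apply: eq_bigr => i _ /=.
by rewrite mxE -scalemxAl mxtraceZ.
Qed.

Lemma linmapD n l (A : 'I_n -> 'M[R]_l) x y : linmap A (x + y) = linmap A x + linmap A y.
Proof.
by rewrite /linmap -big_split; apply: eq_bigr => i _; rewrite mxE scalerDl.
Qed.

Lemma linmapZ n l (A : 'I_n -> 'M[R]_l) a x : linmap A (a *: x) = a *: linmap A x.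
Proof.
by rewrite /linmap scaler_sumr; apply: eq_bigr => i _; rewrite mxE scalerA.
Qed.

Lemma linmap0 n l (A : 'I_n -> 'M[R]_l) : linmap A 0 = 0.
Proof. by rewrite -(scale0r 0) linmapZ scale0r. Qed.

Lemma linmap_sym n l (A : 'I_n -> 'M[R]_l) x :
  (forall i, (A i)^T = A i) -> (linmap A x)^T = linmap A x.
Proof.
by move=> As; rewrite linear_sum; apply: eq_bigr => i _; rewrite linearZ /= As.
Qed.

Lemma mxdot_mxvec l (X V : 'M[R]_l) : mxdot X V = dot (mxvec X)^T (mxvec V^T)^T.
Proof.
rewrite /mxdot dotE /mxtrace (eq_bigr (fun i => \sum_j X i j * V j i)); last first.
  by move=> i _; rewrite mxE.
rewrite pair_big /= (reindex _ (curry_mxvec_bij l l)) /=; apply: eq_bigr => -[i j] _ /=.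
by rewrite 2!mxE 2!mxvecE mxE.
Qed.

End Semidefinite.

(** * Pairing of semidefinite matrices and strong duality *)

Section Duality.
Context {R : realType}.

(** Turns a bound valid along a whole ray into the sign of the functional on that ray. A negative
    slope would give a zero at t = - a / b. *)
Lemma affine_ge0_slope (a b : R) : (forall t, 0 <= t -> 0 < a + t * b) -> 0 <= b.
Proof.
move=> H; rewrite leNgt; apply/negP => b0.
have a0 : 0 < a by have := H 0 (lexx 0); rewrite mul0r addr0.
have := H (a / - b); rewrite invrN mulrN mulNr divfK ?lt_eqF // subrr ltxx.
by rewrite -mulrN -invrN divr_ge0 ?(ltW a0) ?oppr_ge0 ?(ltW b0) // => /(_ isT).
Qed.

Lemma psd_rank1 l (u : 'cV[R]_l) : psd (u *m u^T).
Proof.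
split=> [|v]; first by rewrite trmx_mul trmxK.
rewrite /dot -!mulmxA mulmxA -{1}[u]trmxK -trmx_mul.
set c := u^T *m v; have -> : (c^T *m c) 0 0 = c 0 0 * c 0 0.
  by rewrite mxE big_ord1 mxE.
by rewrite -expr2 sqr_ge0.
Qed.

(** With a zero diagonal entry, the form at v + s e_k is affine in s, and being nonnegative for all
    s it has slope 0. *)
Lemma psd_diag_eq0 l (X : 'M[R]_l) k v :
  psd X -> X k k = 0 -> dot (col k X) v = 0.
Proof.
move=> [Xs X0] Xkk; have Xe : dot v (X *m delta_mx k 0) = dot (col k X) v.
  by rewrite colE dotC.
have eX : dot (delta_mx k 0) (X *m v) = dot (col k X) v.
  by rewrite colE /dot -{1}Xs mulmxA -trmx_mul.
have eXe : dot (delta_mx k 0) (X *m delta_mx k 0) = 0.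
  by rewrite dot_deltal -colE mxE.
have H s : 0 <= dot v (X *m v) + s * (2 * dot (col k X) v).
  have := X0 (v + s *: delta_mx k 0).
  rewrite mulmxDr -scalemxAr dotDl !dotDr !dotZl !dotZr Xe eX eXe.
  by congr (0 <= _); ring.
set b := dot (col k X) v in H *; set a := dot v (X *m v) in H.
have b0 : 0 <= 2 * b.
  by apply: (@affine_ge0_slope (a + 1)) => t _; have := H t; lra.
have b1 : 0 <= - (2 * b).
  by apply: (@affine_ge0_slope (a + 1)) => t _; have := H (- t); lra.
lra.
Qed.

(* One step of Cholesky elimination; for X k k = 0 nothing is subtracted, as
   0^-1 = 0, and row k of X already vanishes. *)
Lemma psd_pivot l (X : 'M[R]_l) k :
  psd X -> psd (X - (X k k)^-1 *: (col k X *m (col k X)^T)).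
Proof.
move=> pX; have [Xs X0] := pX; set u := col k X.
split=> [|v]; first by rewrite linearB linearZ /= trmx_mul trmxK Xs.
have uE : dot v ((u *m u^T) *m v) = dot u v ^+ 2.
  rewrite /dot -!mulmxA mulmxA -{1}[u]trmxK -trmx_mul.
  by set c := u^T *m v; rewrite mxE big_ord1 mxE expr2.
rewrite mulmxBl dotBr -scalemxAl dotZr uE.
have [a0|a0] := eqVneq (X k k) 0.
  by rewrite psd_diag_eq0 // expr0n mulr0 subr0.
have Xe : dot v (X *m delta_mx k 0) = dot u v by rewrite -colE dotC.
have eX : dot (delta_mx k 0) (X *m v) = dot u v.
  by rewrite /u colE /dot -{1}Xs mulmxA -trmx_mul.
have eXe : dot (delta_mx k 0) (X *m delta_mx k 0) = X k k.
  by rewrite dot_deltal -colE mxE.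
(* This multiple of e_k minimises the form of X on the line v + s e_k; the minimum is the form of
   the reduced matrix at v. *)
have := X0 (v - (dot u v / X k k) *: delta_mx k 0).
rewrite mulmxBr -scalemxAr dotBl !dotBr !dotZl !dotZr Xe eX eXe.
by congr (0 <= _); field.
Qed.

Lemma mxdot_rank1 l (u : 'cV[R]_l) V : mxdot (u *m u^T) V = dot u (V *m u).
Proof.
by rewrite /mxdot mxtrace_mulC mulmxA mxtrace_mulC /dot /mxtrace big_ord1.
Qed.

(** Successive pivots write X as a nonnegative combination of matrices u u^T, and each of them pairs
    with V to the value of the form of V at u. *)
Lemma mxdot_psd_ge0 l (X V : 'M[R]_l) : psd X -> psd V -> 0 <= mxdot X V.
Proof.
move=> pX [_ V0].
(* m counts the trailing rows that elimination has not yet cleared. *)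
suff main m : forall Y, psd Y -> (m <= l)%N ->
    (forall i j : 'I_l, (i < l - m)%N -> Y i j = 0) -> 0 <= mxdot Y V.
  by apply: (main l) => // i j; rewrite subnn.
elim: m {X pX} => [|m IH] X pX ml Xz.
  have -> : X = 0 by apply/matrixP => i j; rewrite Xz ?mxE // subn0.
  by rewrite /mxdot mul0mx mxtrace0.
have kl : (l - m.+1 < l)%N by rewrite ltn_subrL (leq_ltn_trans _ ml).
pose k := Ordinal kl; set u := col k X.
pose X' := X - (X k k)^-1 *: (u *m u^T).
have -> : X = X' + (X k k)^-1 *: (u *m u^T) by rewrite subrK.
have akk : 0 <= X k k.
  by have := pX.2 (delta_mx k 0); rewrite dot_deltal -colE mxE.
rewrite mxdotDl mxdotZl mxdot_rank1 addr_ge0 ?mulr_ge0 ?invr_ge0 //.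
apply: IH (psd_pivot k pX) (ltnW ml) _ => i j ilt.
rewrite !mxE big_ord1 !mxE.
have [ik|ik] := ltnP i (l - m.+1).
  by rewrite (Xz i j ik) (Xz i k ik) mul0r mulr0 subr0.
have {ik ilt}-> : i = k.
  by apply/val_inj/eqP; rewrite /= eqn_leq ik andbT -ltnS -subSn.
have Xjk : X j k = X k j by rewrite -[in RHS]pX.1 mxE.
rewrite Xjk; have [a0|a0] := eqVneq (X k k) 0; last by rewrite mulrA mulVf // mul1r subrr.
rewrite a0 mul0r mulr0 subr0 -(psd_diag_eq0 (delta_mx j 0) pX a0).
by rewrite dotC dot_deltal mxE Xjk.
Qed.

(* Fattening the interior of the PSD cone by the order unit Y0 keeps the two
   sides at positive distance, so that no closedness of W is required. *)
Lemma psd_separation l (Y0 : 'M[R]_l) (W : set 'M[R]_l) : pd Y0 ->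
  W 0 -> (forall X Y, W X -> W Y -> W (X + Y)) ->
  (forall a X, 0 <= a -> W X -> W (a *: X)) ->
  (forall X, W X -> X^T = X) -> (forall X, W X -> ~ pd X) ->
  exists V, [/\ psd V, 0 < mxdot Y0 V & forall X, W X -> mxdot X V <= 0].
Proof.
move=> pY W0 WD WZ Ws Wnpd; have [e e0 He] := pd_open pY; have [Ys _] := pY.
pose Z := [set z | exists P M, [/\ psd P, W M & z = mxvec (Y0 + P - M)]].
have Zc z : Z z -> e <= `|z|.
  move=> [P [M [pP WM ->]]]; rewrite leNgt; apply/negP => zlt.
  apply: (Wnpd M) => //.
  (* If the bracket is entrywise below e, this exhibits M as a positive definite matrix plus P,
     which [Wnpd] excludes. *)
  have -> : M = Y0 + - (Y0 + P - M) + P.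
    by apply/matrixP => i j; rewrite !mxE; ring.
  apply: (pdD _ pP); apply: He => [|i j].
    have S : (Y0 + P)^T = Y0 + P by rewrite linearD /= Ys pP.1.
    by rewrite linearN /= [(_ - M)^T]linearB /= (Ws M WM) S.
  rewrite mxE normrN; apply: le_trans (ltW zlt).
  by have := normr_coord_le (mxvec (Y0 + P - M))^T (mxvec_index i j);
     rewrite mxE mxvecE normr_tr.
have Zcvx x y t : 0 <= t <= 1 -> Z x -> Z y -> Z ((1 - t) *: x + t *: y).
  move=> /andP[t0 t1] [P [M [pP WM ->]]] [P' [M' [pP' WM' ->]]].
  exists ((1 - t) *: P + t *: P'), ((1 - t) *: M + t *: M').
  have t1' : 0 <= 1 - t by rewrite subr_ge0.
  split; [apply: psdD; exact: psdZ|apply: WD; exact: WZ|].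
  rewrite -!linearZ -linearD /=; congr mxvec.
  by apply/matrixP => i j; rewrite !mxE; ring.
have Z0 : Z !=set0.
  by exists (mxvec (Y0 + 0 - 0)), 0, 0; split=> //; exact: psd0.
have [v vZ] := separation0 Zcvx Z0 e0 Zc.
(* The separating functional need not be symmetric; its symmetric part agrees with it on symmetric
   matrices. *)
pose U := (vec_mx v)^T; pose V := 2^-1 *: (U + U^T).
have mxdotV X : X^T = X -> mxdot X V = dot v^T (mxvec X)^T.
  move=> Xs; have UT : \tr (X *m U^T) = \tr (X *m U).
    by rewrite -mxtrace_tr trmx_mul trmxK Xs mxtrace_mulC.
  rewrite /mxdot -scalemxAr mxtraceZ mulmxDr mxtraceD UT -/(mxdot X U).
  by rewrite mxdot_mxvec trmxK vec_mxK dotC; field.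
have Vpos P M : psd P -> W M -> 0 < mxdot Y0 V + mxdot P V - mxdot M V.
  move=> pP WM; have -> : mxdot Y0 V + mxdot P V - mxdot M V = mxdot (Y0 + P - M) V.
    by rewrite -[- M]scaleN1r !mxdotDl mxdotZl mulN1r.
  rewrite mxdotV; first by apply: vZ; exists P, M.
  have S : (Y0 + P)^T = Y0 + P by rewrite linearD /= Ys pP.1.
  by rewrite [LHS]linearB /= (Ws M WM) S.
have V0 : 0 < mxdot Y0 V.
  by have := Vpos 0 0 (psd0 _) W0; rewrite /mxdot !mul0mx !mxtrace0 addr0 subr0.
exists V; split=> // [|X WX]; last first.
  rewrite -oppr_ge0; apply: (@affine_ge0_slope (mxdot Y0 V)) => t t0.
  have := Vpos 0 (t *: X) (psd0 _) (WZ _ _ t0 WX).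
  by rewrite mxdotZl {2}/mxdot mul0mx mxtrace0 addr0 mulrN.
split=> [|u]; first by rewrite linearZ linearD /= trmxK addrC.
rewrite -mxdot_rank1.
apply: (@affine_ge0_slope (mxdot Y0 V)) => t t0.
have := Vpos _ 0 (psdZ t0 (psd_rank1 u)) W0.
by rewrite mxdotZl {3}/mxdot mul0mx mxtrace0 subr0.
Qed.

Variables (N M L : nat) (T : shadow_data (R:=R) N M L).
Hypothesis Tsym : sym_data T.

Lemma mxdot_pencil x y V : adjoint (sd_B T) V = 0 ->
  mxdot (pencil T x y) V = mxdot (sd_A0 T) V + dot x (adjoint (sd_A T) V).
Proof. by move=> BV; rewrite /pencil !mxdotDl !mxdot_linmap BV dot0r addr0. Qed.

Lemma weak_duality p d V w t x y :
  D_feasible T d V w -> P_feasible T p d t x y -> t <= D_value T p V.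
Proof.
move=> [Aw BV pV dw] [px xE]; have := mxdot_psd_ge0 px pV.
have {}BV : adjoint (sd_B T) V = 0 by rewrite -[LHS]opprK BV oppr0.
rewrite mxdot_pencil // xE dotDl dotZl /D_value mxdotDl mxdot_linmap.
have -> : dot d (adjoint (sd_A T) V) = - 1 by rewrite -dw -Aw dotNr opprK.
by rewrite mulrN1 addrA subr_ge0.
Qed.

(** Let [ts] be the optimal value. The cone W generated by C + ts E and the range of B contains no
    positive definite matrix, since otherwise [ts] could be increased. A matrix V separating W,
    scaled to satisfy the normalisation, has dual value at most [ts], and weak duality makes it
    optimal. The supremum [ts] itself need not be attained. *)
Lemma strong_duality p d y0 : pd (pencil T p y0) -> ~ P_unbounded T p d ->
  exists V w, D_solution T p d V w.
Proof.
move=> pY nunb.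
pose C := sd_A0 T + linmap (sd_A T) p; pose E := linmap (sd_A T) d.
have pencilE t y : pencil T (p + t *: d) y = C + t *: E + linmap (sd_B T) y.
  by rewrite /pencil linmapD linmapZ addrA.
have [As0 As Bs] := Tsym.
have Cs : C^T = C by rewrite linearD /= As0 linmap_sym.
have Es : E^T = E by rewrite linmap_sym.
pose F := [set t : R | exists y, psd (pencil T (p + t *: d) y)].
have F0 : F 0 by exists y0; rewrite scale0r addr0; exact: pd_psd.
have [c cF] : exists c, forall t, F t -> t <= c.
  apply: contrapT => nF; apply: nunb => c; apply: contrapT => nc; apply: nF.
  exists c => t [y py]; rewrite leNgt; apply/negP => ct; apply: nc.
  by exists t, (p + t *: d), y; split; [split|exact: ltW].
have supF : has_sup F by split; [exists 0|exists c => t Ft; exact: cF].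
pose ts := sup F.
have Fts t : F t -> t <= ts by exact: sup_upper_bound.
pose W := [set X | exists s y, 0 <= s /\ X = s *: (C + ts *: E) + linmap (sd_B T) y].
have Wsym X : W X -> X^T = X.
  move=> [s [y [s0 ->]]].
  have S : (C + ts *: E)^T = C + ts *: E by rewrite linearD linearZ /= Cs Es.
  by rewrite linearD linearZ /= S linmap_sym.
have Wnpd X : W X -> ~ pd X.
  move=> [s [y [s0 ->]]] pX.
  (* Perturbing by C + (ts + 1) E instead of E makes the coefficient s + e of C positive even for s
     = 0; dividing by it gives the feasible value ts + e / (s + e). *)
  have Gs : (C + (ts + 1) *: E)^T = C + (ts + 1) *: E.
    by rewrite linearD linearZ /= Cs Es.
  have [e e0 He] := pd_open_line pX Gs.
  have se : 0 < s + e by lra.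
  have : F (ts + e / (s + e)).
    exists ((s + e)^-1 *: y); rewrite pencilE.
    have -> : C + (ts + e / (s + e)) *: E + linmap (sd_B T) ((s + e)^-1 *: y) =
        (s + e)^-1 *: (s *: (C + ts *: E) + linmap (sd_B T) y +
                       e *: (C + (ts + 1) *: E)).
      rewrite linmapZ; apply/matrixP => i j; rewrite !mxE; field.
      by rewrite gt_eqF.
    by apply: psdZ; [rewrite invr_ge0 ltW|apply/pd_psd/He; rewrite gtr0_norm].
  by move/Fts; rewrite gerDl leNgt divr_gt0.
have W0 : W 0 by exists 0, 0; rewrite scale0r linmap0 addr0.
have WD X Y : W X -> W Y -> W (X + Y).
  move=> [s [y [s0 ->]]] [s' [y' [s'0 ->]]]; exists (s + s'), (y + y').
  by rewrite scalerDl linmapD addrACA addr_ge0.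
have WZ a X : 0 <= a -> W X -> W (a *: X).
  move=> a0 [s [y [s0 ->]]]; exists (a * s), (a *: y).
  by rewrite scalerDr scalerA linmapZ mulr_ge0.
have [V [pV YV WV]] := psd_separation pY W0 WD WZ Wsym Wnpd.
have BV : adjoint (sd_B T) V = 0.
  have BV0 y : dot y (adjoint (sd_B T) V) <= 0.
    rewrite -mxdot_linmap; apply: WV; exists 0, y.
    by rewrite scale0r add0r.
  (* Taking the adjoint vector itself for y bounds its squared norm by 0. *)
  apply/eqP; rewrite -dot_eq0 eq_le dot_ge0 andbT; exact: BV0.
have CV : mxdot C V + ts * mxdot E V <= 0.
  rewrite -mxdotZl -mxdotDl; apply: WV; exists 1, 0.
  by rewrite scale1r linmap0 addr0.
have CV0 : 0 < mxdot C V.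
  by move: YV; rewrite mxdot_pencil // mxdotDl mxdot_linmap.
have ts0 : 0 <= ts by exact: Fts.
have EV : mxdot E V < 0.
  rewrite ltNge; apply/negP => EV; have := mulr_ge0 ts0 EV.
  by clear -CV CV0; lra.
set a := - mxdot E V; have a0 : 0 < a by rewrite oppr_gt0.
exists (a^-1 *: V), (- adjoint (sd_A T) (a^-1 *: V)).
have adjZ k (G : 'I_k -> 'M[R]_L) : adjoint G (a^-1 *: V) = a^-1 *: adjoint G V.
  by apply/colP => i; rewrite !mxE mxdotZr.
split=> [|V' w' feas'].
  split=> //; first by rewrite adjZ BV scaler0 oppr0.
  - by apply: psdZ; rewrite ?invr_ge0 ?ltW.
  - by rewrite dotNr adjZ dotZr -mxdot_linmap -/E -mulrN mulVf // gt_eqF.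
apply: (@le_trans _ _ ts).
  rewrite /D_value mxdotZr ler_pdivrMl // -/C /a; lra.
apply: ge_sup => [|t [y py]]; first by exists 0.
by apply: (@weak_duality p d V' w' t (p + t *: d) y).
Qed.

End Duality.

(** * The conic shadow *)

Section ConeData.
Context {R : realType}.

Lemma shadow_convex_cone N M L (T : shadow_data (R:=R) N M L) :
  sd_A0 T = 0 -> convex_cone (shadow T).
Proof.
move=> A0; split=> [|x x' [y py] [y' py']|a x a0 [y py]].
- by exists 0; rewrite /pencil A0 !linmap0 !addr0; exact: psd0.
- exists (y + y'); move: (psdD py py').
  by rewrite /pencil A0 !linmapD !add0r addrACA.
- exists (a *: y); move: (psdZ a0 py).
  by rewrite /pencil A0 !linmapZ !add0r scalerDr.
Qed.

Lemma dot_block_diag k l (X : 'M[R]_k) (Y : 'M[R]_l) u v :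
  dot (col_mx u v) (block_mx X 0 0 Y *m col_mx u v) =
  dot u (X *m u) + dot v (Y *m v).
Proof. by rewrite mul_block_col !mul0mx addr0 add0r dot_col_mx. Qed.

Lemma psd_block_diag k l (X : 'M[R]_k) (Y : 'M[R]_l) :
  psd (block_mx X 0 0 Y) <-> psd X /\ psd Y.
Proof.
split=> [[XYs XY0]|[[Xs X0] [Ys Y0]]].
  move: XYs; rewrite tr_block_mx !trmx0 => /eq_block_mx[Xs _ _ Ys].
  split; split=> // u.
    by have := XY0 (col_mx u 0); rewrite dot_block_diag mulmx0 dot0r addr0.
  by have := XY0 (col_mx 0 u); rewrite dot_block_diag mulmx0 dot0r add0r.
split=> [|v]; first by rewrite tr_block_mx !trmx0 Xs Ys.
by rewrite -[v]vsubmxK dot_block_diag addr_ge0.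
Qed.

Lemma pd_block_diag k l (X : 'M[R]_k) (Y : 'M[R]_l) :
  pd X -> pd Y -> pd (block_mx X 0 0 Y).
Proof.
move=> pX pY; have [Xs X0] := pX; have [Ys Y0] := pY.
split=> [|v]; first by rewrite tr_block_mx !trmx0 Xs Ys.
rewrite -[v]vsubmxK dot_block_diag; set u := usubmx v; set w := dsubmx v.
have [w0|/Y0 w0] := eqVneq w 0; last by rewrite ltr_wpDl // (pd_psd pX).2.
have [u0|/X0 u0] := eqVneq u 0; last by rewrite ltr_pwDl // (pd_psd pY).2.
by rewrite w0 u0 col_mx0 eqxx.
Qed.

Lemma dot_schur n (x u : 'cV[R]_n) (s t b : R) :
  dot (col_mx u b%:M) (block_mx s%:M x x^T t%:M *m col_mx u b%:M) =
  s * dot u u + 2 * b * dot x u + t * b ^+ 2.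
Proof.
rewrite mul_block_col dot_col_mx !dotDr mul_scalar_mx -scalar_mxM dot1_scalar.
rewrite dotZr mul_mx_scalar dotZr (dotC u x).
have -> : x^T *m u = (dot x u)%:M by rewrite -mx11_scalar.
by rewrite dot1_scalar; ring.
Qed.

Lemma cV_col_scalar n (v : 'cV[R]_(n + 1)) :
  v = col_mx (usubmx v) (dsubmx v 0 0)%:M.
Proof. by rewrite -mx11_scalar vsubmxK. Qed.

Lemma schur_sym n (x : 'cV[R]_n) (s t : R) :
  (block_mx s%:M x x^T t%:M)^T = block_mx s%:M x x^T t%:M.
Proof. by rewrite tr_block_mx !tr_scalar_mx trmxK. Qed.

Lemma schur_pd n (x : 'cV[R]_n) (t : R) :
  dot x x < t -> pd (block_mx 1%:M x x^T t%:M).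
Proof.
move=> xt; split=> [|v]; first exact: schur_sym.
rewrite (cV_col_scalar v); set u := usubmx v; set b := dsubmx v 0 0.
rewrite dot_schur mul1r => v0.
(* Completing the square in u isolates the Schur complement t - |x|^2. *)
have -> : dot u u + 2 * b * dot x u + t * b ^+ 2 =
    dot (u + b *: x) (u + b *: x) + (t - dot x x) * b ^+ 2.
  by rewrite dotDl !dotDr !dotZl !dotZr (dotC u x); ring.
have [b0|b0] := eqVneq b 0; last first.
  by rewrite ltr_wpDl ?dot_ge0 // mulr_gt0 ?subr_gt0 // exprn_even_gt0.
rewrite b0 scale0r addr0 expr0n mulr0 addr0 dot_gt0.
by apply: contra_neq v0 => ->; rewrite b0 raddf0 col_mx0.
Qed.

Lemma schur_psd n (x : 'cV[R]_n) : psd (block_mx 1%:M x x^T (dot x x)%:M).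
Proof.
split=> [|v]; first exact: schur_sym.
rewrite (cV_col_scalar v) dot_schur; set u := usubmx v; set b := dsubmx v 0 0.
have -> : 1 * dot u u + 2 * b * dot x u + dot x x * b ^+ 2 =
    dot (u + b *: x) (u + b *: x).
  by rewrite dotDl !dotDr !dotZl !dotZr (dotC u x); ring.
exact: dot_ge0.
Qed.

Variables (n m l : nat) (D : shadow_data (R:=R) n m l).
Local Notation T := (cone_data D).

Lemma sym_cone_data : sym_data D -> sym_data T.
Proof.
move=> [As0 As Bs]; split=> [|i|j] /=; first exact: trmx0.
- case: (split i) => k; rewrite !tr_block_mx !trmx0.
    by rewrite As !trmx_delta.
  by rewrite As0 tr_scalar_mx.
- case: (split j) => k; rewrite !tr_block_mx !trmx0.
    by rewrite Bs.
  by rewrite tr_scalar_mx.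
Qed.

Lemma col_mx1 k (x : 'cV[R]_k) : col_mx x (1 : 'cV[R]_1) = col_mx x 1%:M.
Proof. by []. Qed.

Lemma cone_data_slater (x : 'cV[R]_n) y : pd (pencil D x y) ->
  exists y', pd (pencil T (col_mx x 1) y').
Proof.
(* The extra 1 makes the Schur complement of the second block equal to 1. *)
move=> pD; exists (col_mx y (dot x x + 1)%:M).
rewrite col_mx1 pencil_cone_data; apply: pd_block_diag.
  by rewrite scale1r [linmap _ _ + _]addrC.
by apply: schur_pd; rewrite ltrDl.
Qed.

Lemma shadow_cone_lift (x : 'cV[R]_n) : shadow D x -> shadow T (col_mx x 1).
Proof.
move=> [y py]; exists (col_mx y (dot x x)%:M).
rewrite col_mx1 pencil_cone_data; apply/psd_block_diag; split.
  by rewrite scale1r [linmap _ _ + _]addrC.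
exact: schur_psd.
Qed.

Lemma shadow_coneP (x : 'cV[R]_n) (s : R) : shadow T (col_mx x s%:M) ->
  exists y t, psd (linmap (sd_A D) x + s *: sd_A0 D + linmap (sd_B D) y) /\
              psd (block_mx s%:M x x^T t%:M).
Proof.
move=> [y]; rewrite (cV_col_scalar y) pencil_cone_data => /psd_block_diag H.
by exists (usubmx y), (dsubmx y 0 0).
Qed.

Lemma shadow_cone_scale (x : 'cV[R]_n) (s : R) : 0 < s ->
  shadow T (col_mx x s%:M) -> shadow D (s^-1 *: x).
Proof.
move=> s0 /shadow_coneP[y [t [py _]]]; exists (s^-1 *: y).
have s0' : 0 <= s^-1 by rewrite invr_ge0 ltW.
move: (psdZ s0' py); rewrite /pencil !linmapZ !scalerDr scalerA mulVf ?gt_eqF //.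
by rewrite scale1r [_ + sd_A0 D]addrC.
Qed.

(** Testing the second block at e_i reads off its diagonal entry s; the index i witnesses that n is
    positive. *)
Lemma shadow_cone_last_ge0 (i : 'I_n) (x : 'cV[R]_n) (s : R) :
  shadow T (col_mx x s%:M) -> 0 <= s.
Proof.
move=> /shadow_coneP[y [t [_ [_ /(_ (col_mx (delta_mx i 0) 0%:M))]]]].
by rewrite dot_schur dot_deltal mxE !eqxx !mulr0 mul0r expr0n mulr0 !addr0 mulr1.
Qed.

End ConeData.

(** * Algorithm R *)

Section Rounds.
Context {R : realType}.

(** Total boundedness of the box through a grid: a cell records the truncated coordinates. The mesh
    h lies strictly below rho because the coordinates only give a distance at most h. *)
Lemma finite_cells (N : nat) (B rho : R) : 0 < rho ->
  exists (C : finType) (cell : 'cV[R]_N -> C), forall x y,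
    `|x| <= B -> `|y| <= B -> cell x = cell y -> `|x - y| < rho.
Proof.
move=> rho0; have [h h0 hrho] : exists2 h, 0 < h & h < rho by exists (rho / 2); lra.
pose K := Num.truncn ((2 * B) / h).
exists {ffun 'I_N -> 'I_K.+1},
  (fun x => [ffun i => inord (Num.truncn ((x i 0 + B) / h))]) => x y xB yB xy.
apply: le_lt_trans hrho.
apply: normr_le_coord => [|i]; first exact: ltW.
have coord (z : 'cV[R]_N) : `|z| <= B -> 0 <= z i 0 + B <= 2 * B.
  move=> zB; have := le_trans (normr_coord_le z i) zB.
  by rewrite ler_norml => /andP[? ?]; apply/andP; split; lra.
have trK (z : 'cV[R]_N) : `|z| <= B -> (Num.truncn (((z i 0 + B) / h)%R) < K.+1)%N.
  move=> /coord /andP[z0 zB]; rewrite ltnS /K; apply: le_truncn.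
  by rewrite ler_pM2r // invr_gt0.
have := congr1 (fun f : {ffun 'I_N -> 'I_K.+1} => val (f i)) xy.
rewrite !ffunE /= !inordK ?trK // => E.
have /andP[x0 _] := coord x xB; have /andP[y0 _] := coord y yB.
have hV : 0 <= h^-1 by rewrite invr_ge0 ltW.
have /andP[] := truncn_itv (mulr_ge0 x0 hV); have /andP[] := truncn_itv (mulr_ge0 y0 hV).
rewrite E; set k := Num.truncn _; rewrite !ler_pdivlMr // !ltr_pdivrMr // -natr1.
rewrite mulrDl mul1r !mxE ler_norml => *; apply/andP; split; lra.
Qed.

Variables (N M L : nat) (T : shadow_data (R:=R) N M L).
Hypotheses (Tsym : sym_data T) (T0 : sd_A0 T = 0).
Variables (p : 'cV[R]_N) (y0 : 'cV[R]_M) (delta : R).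
Hypotheses (slater : pd (pencil T p y0)) (p0 : p != 0) (delta0 : 0 < delta).

Let dbar : 'cV[R]_N := (enorm p)^-1 *: p.
Let p_gt0 : 0 < enorm p. Proof. by rewrite enorm_gt0. Qed.

Implicit Types (r d w : 'cV[R]_N).

Lemma dir0 r : dir dbar r 0 = dbar.
Proof. by rewrite /dir expr0 subrr mul0r scale0r add0r divr1 scale1r. Qed.

Lemma subr_dir r k : r - dir dbar r k = (2 ^+ k)^-1 *: (r - dbar).
Proof.
have k0 : (2 : R) ^+ k != 0 by rewrite expf_neq0 // pnatr_eq0.
by apply/colP => i; rewrite /dir !mxE; field; rewrite k0 gt_eqF.
Qed.

(** By [subr_dir], iteration k + 1 takes place exactly when direction k is still farther than delta
    from r. *)
Lemma niter_geE r k :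
  (k.+1%:Z <= niter dbar delta r) = (2 ^+ k < enorm (r - dbar) / delta).
Proof.
have ln2 : 0 < ln 2 :> R by rewrite ln_gt0 // ltr1n.
rewrite /niter -addn1 PoszD lezD1 ceil_gt_int ltr_pdivlMr //.
have a0 : 0 <= enorm (r - dbar) / delta by rewrite divr_ge0 ?enorm_ge0 // ltW.
set a := enorm (r - dbar) / delta in a0 *.
(* For r = dbar the convention ln 0 = 0 makes both sides false. *)
have [->|a1] := eqVneq a 0.
  rewrite (ln0 (lexx 0)) !ltNge mulr_ge0 ?(ltW ln2) //.
  by rewrite exprn_ge0.
have {a1}a0 : 0 < a by rewrite lt_def a1.
have -> : (2 ^+ k < a) = (ln (2 ^+ k) < ln a) by rewrite ltr_ln // posrE exprn_gt0.
rewrite lnXn // -(mulr_natl (ln 2) k).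
by rewrite -pmulrn.
Qed.

Lemma dirE r k : dir dbar r k = (1 - (2 ^+ k)^-1) *: r + (2 ^+ k)^-1 *: dbar.
Proof.
have k0 : (2 : R) ^+ k != 0 by rewrite expf_neq0 // pnatr_eq0.
by rewrite /dir mulrBl divff // div1r.
Qed.

Lemma half_pow_itv k : 0 <= ((2 : R) ^+ k)^-1 <= 1.
Proof.
have k1 : (1 : R) <= 2 ^+ k by rewrite exprn_ege1 // ler1n.
have k0 : (0 : R) <= 2 ^+ k by rewrite exprn_ge0.
by rewrite invr_ge0 k0 invf_le1 // (lt_le_trans ltr01 k1).
Qed.

Lemma dir_normr_le r k : `|r| <= 1 -> `|dir dbar r k| <= 1 + `|dbar|.
Proof.
move=> r1; have /andP[h0 h1] := half_pow_itv k.
rewrite dirE (le_trans (ler_normD _ _)) // !normrZ lerD //.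
  rewrite ger0_norm ?subr_ge0 // mulr_ile1 // ?subr_ge0 //; lra.
by rewrite ger0_norm // ler_piMl.
Qed.

Lemma shadow_start : shadow T p.
Proof. by exists y0; exact: pd_psd. Qed.

(** As A0 = 0 and V annihilates the range of B, - w x is the pairing of V with the semidefinite
    pencil at x. *)
Lemma D_feasible_cut d V w : D_feasible T d V w -> shadow T `<=` halfspace w 0.
Proof.
move=> [<- BV pV _] x [y py]; rewrite /halfspace /= dotNl oppr_le0 dotC.
have {}BV : adjoint (sd_B T) V = 0 by rewrite -[LHS]opprK BV oppr0.
have := mxdot_psd_ge0 py pV.
by rewrite mxdot_pencil // T0 {1}/mxdot mul0mx mxtrace0 add0r.
Qed.

(* The shadow contains p + s e_i for all small s of either sign. *)
Lemma cut_margin : exists2 e, 0 < e & forall w,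
  shadow T `<=` halfspace w 0 -> forall i, e * `|w i 0| <= - dot w p.
Proof.
have [e e0 He] := pd_open slater; have [_ As _] := Tsym.
pose S : R := \sum_i \sum_j \sum_k `|sd_A T i j k|.
have S0 : 0 <= S.
  by apply: sumr_ge0 => i _; apply: sumr_ge0 => j _; apply: sumr_ge0.
have S1 : 0 < 1 + S by lra.
exists (e / (1 + S)); first exact: divr_gt0.
move=> w cutw i.
have line s : `|s| <= e / (1 + S) -> shadow T (p + s *: delta_mx i 0).
  move=> se; exists y0; apply: pd_psd.
  have -> : pencil T (p + s *: delta_mx i 0) y0 = pencil T p y0 + s *: sd_A T i.
    rewrite /pencil linmapD linmapZ addrA [RHS]addrAC; congr (_ + _ *: _ + _).
    rewrite /linmap (bigD1 i) //= mxE !eqxx scale1r big1 ?addr0 // => j ji.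
    by rewrite mxE (negPf ji) scale0r.
  apply: He => [|j k]; first by rewrite linearZ /= As.
  rewrite mxE normrM; apply: (@le_trans _ _ (e / (1 + S) * (1 + S))).
    rewrite ler_pM //; apply: (@le_trans _ _ S); last by rewrite lerDr.
    rewrite /S (bigD1 i) //= (bigD1 j) //= (bigD1 k) //= -!addrA lerDl.
    rewrite !addr_ge0 // ?sumr_ge0 // => ? _; rewrite sumr_ge0 // => ? _.
    exact: sumr_ge0.
  by rewrite divfK // gt_eqF.
have s0 : 0 <= e / (1 + S) by rewrite divr_ge0 // ltW.
have wi : dot w (delta_mx i 0) = w i 0 by rewrite dotC dot_deltal.
have := cutw _ (line (e / (1 + S)) _); rewrite ger0_norm // => /(_ (lexx _)).
have := cutw _ (line (- (e / (1 + S))) _).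
rewrite normrN ger0_norm // => /(_ (lexx _)).
rewrite /halfspace /= !dotDr !dotZr wi => H1 H2.
have [wi0|wi0] := lerP 0 (w i 0); [rewrite ger0_norm|rewrite ltr0_norm] => //; lra.
Qed.

(** The points p + t d of the cone T, divided by t, tend to d. *)
Lemma P_unbounded_closure d : P_unbounded T p d -> closure (shadow T) d.
Proof.
move=> unb; apply/closure_normP => e e0.
have [t [x [y [[pxy xE] tge]]]] := unb (`|p| / e + 1).
have t1 : 0 < t by apply: lt_le_trans tge; rewrite ltr_wpDl // divr_ge0 // ltW.
have [_ _ TZ] := shadow_convex_cone T0.
exists (t^-1 *: x); first by apply: TZ; [rewrite invr_ge0 ltW|exists y].
rewrite xE scalerDr scalerA mulVf ?gt_eqF // scale1r opprD addrCA subrr addr0.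
rewrite normrN normrZ ger0_norm ?invr_ge0 ?ltW // mulrC ltr_pdivrMr //.
by rewrite mulrC -ltr_pdivrMr // (lt_le_trans _ tge) // ltrDl.
Qed.

(* w is positive at d, but at the new direction at most 2^-k (dot w p) / |p|,
   where k is bounded; the normal w is controlled by cut_margin. *)
Lemma dir_separated : exists2 rho, 0 < rho & forall w d r k,
  shadow T `<=` halfspace w 0 -> 0 < dot w d -> dot w r <= 0 -> `|r| <= 1 ->
  k.+1%:Z <= niter dbar delta r -> rho <= `|d - dir dbar r k.+1|.
Proof.
have [e e0 He] := cut_margin.
pose c := N.+1%:R * (1 + `|dbar|).
have c0 : 0 < c by rewrite mulr_gt0 // ltr_wpDr.
(* c bounds the Euclidean norm of r - dbar, so an executed iteration k + 1 has 2^k < c / delta, and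
   its weight on dbar is at least [kap]. *)
pose kap := delta / (2 * c).
have kap0 : 0 < kap by rewrite divr_gt0 // mulr_gt0.
have q0 : 0 < N.+1%:R * enorm p by rewrite mulr_gt0.
(* With q = - w p, the values of w at the two directions differ by more than kap q / |p|, while
   [cut_margin] bounds the sum of the |w_i| by (N + 1) q / e. The quotient is this constant, free of
   q. *)
exists (kap * e / (N.+1%:R * enorm p)); first by rewrite divr_gt0 // mulr_gt0.
move=> w d r k cutw wd wr r1; rewrite niter_geE => kr.
have hk : kap <= (2 ^+ k.+1)^-1.
  have : 2 ^+ k < c / delta.
    apply: lt_le_trans kr _; rewrite ler_pM2r ?invr_gt0 //.
    apply: le_trans (enorm_le_normr _) _; rewrite ler_wpM2l //.
    by rewrite (le_trans (ler_normB _ _)) // lerD2r.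
  rewrite ltr_pdivlMr // => H.
  have k0 : 0 < (2 : R) ^+ k by rewrite exprn_gt0.
  rewrite exprS /kap ler_pdivrMr ?mulr_gt0 // mulrC ler_pdivlMr ?mulr_gt0 //.
  by move: H; lra.
have /andP[h0 h1] := half_pow_itv k.+1.
have wp : 0 <= - dot w p.
  have [i _] : exists i, p i 0 != 0.
    apply: contrapT => H; move/eqP: p0; apply; apply/colP => i; rewrite mxE.
    by apply: contrapT => /eqP pi; apply: H; exists i.
  by apply: le_trans (He w cutw i); rewrite mulr_ge0 // ltW.
have wdir : dot w (dir dbar r k.+1) <= - (kap * (- dot w p / enorm p)).
  rewrite dirE dotDr !dotZr.
  have -> : (enorm p)^-1 * dot w p = - (- dot w p / enorm p) by rewrite mulNr opprK mulrC.
  have z0 : 0 <= - dot w p / enorm p by rewrite divr_ge0 // ltW.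
  set z := _ / enorm p in z0 *.
  have : (1 - (2 ^+ k.+1)^-1) * dot w r <= 0 by rewrite mulr_ge0_le0 // subr_ge0.
  have : kap * z <= (2 ^+ k.+1)^-1 * z by rewrite ler_wpM2r.
  lra.
have wS : e * (\sum_i `|w i 0|) <= N.+1%:R * - dot w p.
  rewrite mulr_sumr; apply: (@le_trans _ _ (\sum_(i < N) - dot w p)).
    by apply: ler_sum => i _; exact: He.
  by rewrite sumr_const card_ord -[leLHS]mulr_natl ler_wpM2r // ler_nat.
have := le_trans (ler_norm _) (normr_dot_le w (d - dir dbar r k.+1)).
rewrite dotBr; set u := `|_|; set s := \sum_i _ in wS *; set q := - dot w p in wdir wS *.
move=> H; have u0 : 0 <= u by exact: normr_ge0.
rewrite ler_pdivrMr //.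
have H1 : kap * (q / enorm p) < s * u by lra.
have q1 : 0 < q.
  rewrite lt_def wp andbT; apply/eqP => q00; move: H1 wS; rewrite q00 mul0r !mulr0 => H1.
  rewrite pmulr_rle0 // => s0.
  have : s * u <= 0 by rewrite mulr_le0_ge0.
  lra.
have H2 : kap * q < s * u * enorm p by rewrite -ltr_pdivrMr // -mulrA.
have H3 : e * (s * u * enorm p) <= N.+1%:R * q * (u * enorm p).
  have uP : 0 <= u * enorm p by rewrite mulr_ge0 // ltW.
  by have := ler_wpM2r uP wS; lra.
have H4 : e * (kap * q) < N.+1%:R * q * (u * enorm p).
  by apply: lt_le_trans H3; rewrite ltr_pM2l.
by rewrite -(ler_pM2r q1); lra.
Qed.

Local Notation step := (stepR T p dbar delta).

(* The measure of a pass is the number of grid cells met by the directions that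
   its outer cone still allows; a cut frees the cell of the direction cut off. *)
Lemma stepR_terminates KO KI : Acc (fun s' s => step s s') (Pass KO KI).
Proof.
have [rho rho0 sep] := dir_separated.
have [C [cell cellP]] := finite_cells N (1 + `|dbar|) rho0.
pose hit (K : set 'cV[R]_N) c := exists r k,
  [/\ K r, `|r| <= 1, k.+1%:Z <= niter dbar delta r & cell (dir dbar r k.+1) = c].
pose mu K := #|[set c | `[< hit K c >]]%SET|.
have hitS K K' c : K `<=` K' -> hit K c -> hit K' c.
  by move=> KK' [r [k [Kr r1 kr rc]]]; exists r, k; split=> //; exact: KK'.
have muS K K' : K `<=` K' -> (mu K <= mu K')%N.
  move=> KK'; apply/subset_leq_card/fintype.subsetP => c; rewrite !finset.inE.
  by move=> /asboolP Kc; apply/asboolP; exact: hitS Kc.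
have mu_cut K0 K r k V w : K0 r -> `|r| <= 1 -> k.+1%:Z <= niter dbar delta r ->
    D_feasible T (dir dbar r k.+1) V w -> K `<=` K0 ->
    (mu (K `&` halfspace w 0) < mu K0)%N.
  move=> K0r r1 kr feas KK0; apply: proper_card; apply/properP; split.
    apply/fintype.subsetP => c; rewrite !finset.inE => /asboolP Kc; apply/asboolP.
    by apply: hitS Kc => x [/KK0].
  exists (cell (dir dbar r k.+1)); rewrite finset.inE.
    by apply/asboolP; exists r, k.
  apply/asboolP => -[r' [k' [[_ wr'] r'1 k'r' E]]].
  (* A direction still allowed in the same cell would be closer than rho to the one cut off, against
     [sep]. *)
  have [_ _ _ dw] := feas.
  have := cellP _ _ (dir_normr_le k.+1 r1) (dir_normr_le k'.+1 r'1) (esym E).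
  rewrite ltNge (sep w) //; first exact: D_feasible_cut feas.
  by rewrite dotC dw.
have [m] := ubnP (mu KO); elim: m KO KI => [//|m IH] KO0 KI0; rewrite ltnS => KOm.
have passAcc KO KI : (mu KO < mu KO0)%N -> Acc (fun s' s => step s s') (Pass KO KI).
  by move=> lt; apply: IH; exact: leq_trans lt KOm.
(* The vertices belong to the cone [KO0] at the start of the pass and may have been cut off since.
   So the measure is compared with that of [KO0], and it has dropped once [stop] is false. *)
have vertAcc rs : forall KO KI stop, KO `<=` KO0 ->
    (stop = false -> (mu KO < mu KO0)%N) ->
    {in rs, forall r, KO0 r /\ `|r| <= 1} ->
    Acc (fun s' s => step s s') (ForVert KO KI rs stop).
  elim: rs => [|r rs IHrs] KO KI stop KS st rsP; constructor => s' H.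
    inversion H; subst.
      by constructor => s'' H'; inversion H'.
    by apply: passAcc; exact: st.
  have [K0r r1] : KO0 r /\ `|r| <= 1 by apply: rsP; rewrite mem_head.
  have {}rsP : {in rs, forall r, KO0 r /\ `|r| <= 1}.
    by move=> x xs; apply: rsP; rewrite inE xs orbT.
  inversion H; subst => {H}.
  (* j bounds the remaining values of k; the absolute value turns a possibly negative number of
     iterations into a natural bound. *)
  suff kAcc j : forall k KI, (0 < k)%N -> (`|niter dbar delta r|%N < k + j)%N ->
      Acc (fun s' s => step s s') (ForK KO KI r k rs stop).
    by apply: (kAcc `|niter dbar delta r|%N) => //; rewrite add1n.
  elim: j => [|j IHj] [//|k] {}KI _ kj; constructor => s' H.
    have nk : niter dbar delta r < k.+1%:Z.
      by rewrite addn0 in kj; apply: le_lt_trans (ler_norm _) _; rewrite -abszE ltz_nat.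
    inversion H; subst; first exact: IHrs.
    - by move: nk; rewrite ltNge => /negP[].
    - by move: nk; rewrite ltNge => /negP[].
  inversion H; subst; first exact: IHrs.
    by apply: IHj => //; rewrite addSnnS.
  have lt : (mu (KO `&` halfspace w 0) < mu KO0)%N.
    have [feas _] : D_solution T p (dir dbar r k.+1) V w by [].
    exact: mu_cut feas KS.
  by apply: IHrs => // x [/KS].
constructor => s' H; inversion H; subst.
have rsP r : r \in rs <-> box_vertices KO0 r by [].
by apply: vertAcc => // r /rsP[[[]]].
Qed.

(** * Invariant of Algorithm R and its consequences *)

Definition near_cone (K : set 'cV[R]_N) r :=
  exists2 y, K y & enorm (r - y) <= delta.

Record pair_invariant (KO KI : set 'cV[R]_N) : Prop := PairInvariant {
  pair_bounded : ~ P_unbounded T p (- dbar);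
  pair_outer : exists hs, KO = pcone hs;
  pair_inner : exists hs, KI = pcone hs;
  pair_shadow_outer : shadow T `<=` KO;
  pair_inner_shadow : KI `<=` closure (shadow T);
  pair_dbar : KI dbar
}.

(** In [ForK] the preceding direction already lies in KI; for k = 1 it is dbar. As long as [stop] is
    true, KO has not changed during the pass, so each of its vertices is either pending or known to
    be near KI. *)
Definition state_invariant (s : stateR N) : Prop :=
  match s with
  | Init => True
  | Pass KO KI => pair_invariant KO KI
  | ForVert KO KI rs stop => pair_invariant KO KI /\
      (stop -> forall r, box_vertices KO r -> r \in rs \/ near_cone KI r)
  | ForK KO KI r k rs stop => [/\ pair_invariant KO KI, (0 < k)%N,
      KI (dir dbar r k.-1) &
      stop -> forall r', box_vertices KO r' -> r' \in r :: rs \/ near_cone KI r']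
  | Done KO KI => [/\ P_unbounded T p (- dbar), KO = setT & KI = setT] \/
      (pair_invariant KO KI /\ forall r, box_vertices KO r -> near_cone KI r)
  end.

Lemma near_coneS K K' r : K `<=` K' -> near_cone K r -> near_cone K' r.
Proof. by move=> KK' [y Ky yr]; exists y => //; exact: KK'. Qed.

Lemma closure_shadow_cone : convex_cone (closure (shadow T)).
Proof. exact/closure_convex_cone/shadow_convex_cone. Qed.

Lemma dbar_shadow : shadow T dbar.
Proof.
have [_ _ TZ] := shadow_convex_cone T0.
by apply: TZ; [rewrite invr_ge0 enorm_ge0|exact: shadow_start].
Qed.

Lemma pair_invariant_cut KO KI d V w : pair_invariant KO KI ->
  D_feasible T d V w -> pair_invariant (KO `&` halfspace w 0) KI.
Proof.
move=> [nunb [hs ->] KIp TKO KIT KId] feas; split=> //.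
  by exists (w :: hs); rewrite pcone_cons.
by move=> x Tx; split; [exact: TKO|exact: D_feasible_cut feas _ Tx].
Qed.

Lemma pair_invariant_add KO KI d : pair_invariant KO KI ->
  P_unbounded T p d -> pair_invariant KO (cone (KI `|` [set d])).
Proof.
move=> [nunb KOp [hs E] TKO KIT KId] unb; split=> //.
- by rewrite E; exact: pcone_cone_setU1.
- apply: cone_sub closure_shadow_cone _ => x [/KIT //|->].
  exact: P_unbounded_closure.
- by apply: sub_cone; left.
Qed.

(** Direction k is at distance |r - dbar| / 2^k from r, and the loop ends only when this is at most
    delta. *)
Lemma near_last_dir KI r k : KI (dir dbar r k) ->
  niter dbar delta r < k.+1%:Z -> near_cone KI r.
Proof.
move=> Kd; rewrite ltNge niter_geE -leNgt => rk; exists (dir dbar r k) => //.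
have k0 : 0 < (2 : R) ^+ k by rewrite exprn_gt0.
rewrite subr_dir enormZ ger0_norm ?invr_ge0 ?(ltW k0) // mulrC ler_pdivrMr // mulrC.
by rewrite ler_pdivrMr // in rk.
Qed.

Lemma invariant_step s s' : state_invariant s -> step s s' -> state_invariant s'.
Proof.
move=> inv H; inversion H; subst; move: inv => /=.
- by move=> _; left.
- move=> _; have [feas _] : D_solution T p (- dbar) V w by []; split=> //.
  + by exists [:: w]; rewrite pcone1.
  + exact: pcone_cone_set1.
  + exact: D_feasible_cut feas.
  + apply: cone_sub closure_shadow_cone _ => x ->.
    by apply: subset_closure; exact: dbar_shadow.
  + exact: sub_cone.
- have rsP r : r \in rs <-> box_vertices KO r by [].
  by move=> inv; split=> // _ r /rsP; left.
- by move=> [inv vs]; right; split=> // r /(vs isT)[].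
- by case.
- move=> [inv vs]; split=> //; first by rewrite dir0; case: inv.
- have : niter dbar delta r < k%:Z by [].
  case: k {H H0} => [|k] nk [inv k0 Kd vs] //; split=> // st r' /(vs st).
  rewrite inE => -[/predU1P[->|]|]; [|by left|by right].
  by right; exact: near_last_dir Kd nk.
- move=> [inv k0 Kd vs]; have KK : KI `<=` cone (KI `|` [set dir dbar r k]).
    by move=> x Kx; apply: sub_cone; left.
  split=> //; first exact: pair_invariant_add.
    by apply: sub_cone; right.
  by move=> st r' /(vs st)[|/(near_coneS KK)]; [left|right].
- have [feas _] : D_solution T p (dir dbar r k) V w by [].
  move=> [inv _ _ _]; split=> //.
  exact: pair_invariant_cut feas.
Qed.

Lemma invariant_progress s : state_invariant s ->
  (exists KO KI, s = Done KO KI) \/ exists s', step s s'.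
Proof.
have dual d : ~ P_unbounded T p d -> exists V w, D_solution T p d V w.
  exact: strong_duality slater.
case: s => [|KO KI|KO KI [|r rs] [] |KO KI r k rs stop|KO KI] /= inv.
- right; have [unb|nunb] := pselect (P_unbounded T p (- dbar)).
    by exists (Done setT setT); exact: InitUnbounded.
  have [V [w sol]] := dual _ nunb.
  by exists (Pass (halfspace w 0) (cone [set dbar])); exact: InitBounded sol.
- right; have [_ [hs E] _ _ _ _] := inv; have [rs urs rsP] := box_vertices_finite hs.
  by exists (ForVert KO KI rs true); apply: PassStart => // r; rewrite E.
- by right; exists (Done KO KI); exact: PassStop.
- by right; exists (Pass KO KI); exact: PassAgain.
- by right; exists (ForK KO KI r 1 rs true); exact: VertNext.
- by right; exists (ForK KO KI r 1 rs false); exact: VertNext.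
- right; have [kn|nk] := lerP k%:Z (niter dbar delta r); last first.
    by exists (ForVert KO KI rs stop); exact: KEnd.
  have [unb|nunb] := pselect (P_unbounded T p (dir dbar r k)).
    by eexists; exact: KUnbounded unb.
  have [V [w sol]] := dual _ nunb.
  by eexists; exact: KCut sol.
- by left; exists KO, KI.
Qed.

(** The points within delta of a convex cone form a convex set containing 0, so it suffices to know
    the nonzero vertices. *)
Lemma near_cone_box KO KI : pair_invariant KO KI ->
  (forall r, box_vertices KO r -> near_cone KI r) ->
  forall x, KO x -> `|x| <= 1 -> near_cone KI x.
Proof.
move=> [_ [hs ->] [hs' ->] _ _ _] vs.
have [K0 KD KZ] := convex_cone_pcone hs'.
apply: box_ind => // [y z t /andP[t0 t1] [y' Ky yy'] [z' Kz zz']|]; last first.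
  by exists 0 => //; rewrite subr0 enorm0 ltW.
have t1' : 0 <= 1 - t by rewrite subr_ge0.
exists (t *: y' + (1 - t) *: z'); first by apply: KD; exact: KZ.
rewrite opprD addrACA -!scalerBr (le_trans (enormD _ _)) // !enormZ !ger0_norm //.
have := ler_wpM2l t0 yy'; have := ler_wpM2l t1' zz'; lra.
Qed.

(* Replacing y by its best multiple keeps it in the ball. *)
Lemma near_cone_ball K x : convex_cone K -> enorm x <= 1 -> near_cone K x ->
  exists y, [/\ K y, enorm y <= 1 & enorm (x - y) <= delta].
Proof.
move=> [K0 _ KZ] x1 [y Ky xy].
(* Without an acute angle, 0 is at least as near to x as y; otherwise the projection of x onto the
   ray of y is nearest, and no longer than x. *)
have [xy0|xy0] := lerP (dot x y) 0.
  exists 0; split=> //; first by rewrite enorm0.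
  rewrite subr0 (le_trans _ xy) // -(@ler_pXn2r _ 2) ?nnegrE ?enorm_ge0 //.
  by rewrite !sqr_enorm dotBl !dotBr (dotC y x); have := dot_ge0 y; lra.
have y0' : 0 < dot y y.
  by rewrite dot_gt0; apply: contraTneq xy0 => ->; rewrite dot0r ltxx.
pose s := dot x y / dot y y; have s0 : 0 <= s by rewrite divr_ge0 ?ltW.
have sy : s * dot y y = dot x y by rewrite /s divfK ?gt_eqF.
have ss := dot_ge0 (y - s *: y); have xs := dot_ge0 (x - s *: y).
rewrite !dotBl !dotBr !dotZl !dotZr sy in ss xs; rewrite (dotC y x) in xs.
exists (s *: y); split; first exact: KZ.
  apply: le_trans x1; rewrite -(@ler_pXn2r _ 2) ?nnegrE ?enorm_ge0 //.
  by rewrite !sqr_enorm dotZl dotZr sy; lra.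
apply: le_trans xy; rewrite -(@ler_pXn2r _ 2) ?nnegrE ?enorm_ge0 //.
rewrite !sqr_enorm !dotBl !dotBr !dotZl !dotZr sy (dotC y x); lra.
Qed.

End Rounds.

(** * Algorithm H *)

Section Slices.
Context {R : realType}.
Variable n : nat.
Implicit Types (K : set 'cV[R]_(n + 1)) (C : set 'cV[R]_n).

Lemma dot_last (z : 'cV[R]_(n + 1)) : dot (col_mx 0 1) z = dsubmx z 0 0.
Proof.
rewrite {1}(cV_col_scalar z) dot_col_mx dotC dot0r add0r -[1]/(1%:M : 'cV_1).
by rewrite dot1_scalar mul1r.
Qed.

Lemma sliceE K x : slice K x <-> K (col_mx x 1).
Proof.
split=> [[z [Kz]]|Kx].
  rewrite /hyperplane /= dot_last => z1 <-.
  by move: Kz; rewrite {1}(cV_col_scalar z) z1.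
exists (col_mx x 1); last by rewrite col_mxKu.
by split=> //; rewrite /hyperplane /= dot_last col_mxKd mxE eqxx.
Qed.

Lemma slice_pcone_polyhedron hs : polyhedron (slice (pcone hs : set 'cV[R]_(n + 1))).
Proof.
exists [seq (usubmx h, - dsubmx h 0 0) | h <- hs].
have E h x : (dot h (col_mx x 1) <= 0) = (dot (usubmx h) x <= - dsubmx h 0 0).
  rewrite {1}(cV_col_scalar h) dot_col_mx -[1 in LHS]/(1%:M : 'cV_1) dot1_scalar.
  by rewrite mulr1 -lerBrDr sub0r.
apply/seteqP; split=> x; first move=> /sliceE Kx _ /mapP[h hh ->].
  by rewrite /halfspace /= -E; exact: Kx.
move=> Hx; apply/sliceE => h hh; rewrite E.
exact: (Hx (usubmx h, - dsubmx h 0 0) (map_f (fun h => (usubmx h, - dsubmx h 0 0)) hh)).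
Qed.

Lemma homog_sub C K : convex_cone K -> closed K -> lift1 C `<=` K -> homog C `<=` K.
Proof.
move=> cK clK CK; have /closure_id -> := clK.
by apply: closureS; exact: cone_sub.
Qed.

Lemma lift1_slice K : lift1 (slice K) `<=` K.
Proof. by move=> _ [x /sliceE Kx <-]. Qed.

(* Elements at height 0 are limits of elements at positive height. *)
Lemma sub_homog_slice K x0 : convex_cone K -> K (col_mx x0 1) ->
  (forall z, K z -> 0 <= dsubmx z 0 0) -> K `<=` homog (slice K).
Proof.
move=> [_ KD KZ] Kp Kge z Kz; apply/closure_normP => e e0.
set p := col_mx x0 1 in Kp; have p1 : 0 < 1 + `|p| by rewrite ltr_wpDr.
pose t := e / (1 + `|p|); have t0 : 0 < t by exact: divr_gt0.
exists (z + t *: p); last first.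
  rewrite opprD addrA subrr sub0r normrN normrZ gtr0_norm // /t mulrAC.
  by rewrite ltr_pdivrMr // ltr_pM2l // ltrDr.
have Ky : K (z + t *: p) by apply: KD => //; apply: KZ => //; exact: ltW.
set y := z + t *: p in Ky *; set s := dsubmx y 0 0.
have s0 : 0 < s.
  rewrite /s /y linearD linearZ /= col_mxKd !mxE eqxx mulr1.
  by have := Kge z Kz; rewrite mxE => ?; rewrite ltr_wpDl.
have [_ _ cZ] := convex_cone_cone (lift1 (slice K)).
have -> : y = s *: (s^-1 *: y) by rewrite scalerA mulfV ?gt_eqF // scale1r.
apply: cZ; first exact: ltW.
apply: sub_cone; exists (s^-1 *: usubmx y).
  have E : col_mx (s^-1 *: usubmx y) 1 = s^-1 *: y.
    rewrite [in RHS](cV_col_scalar y) scale_col_mx scale_scalar_mx -/s.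
    by rewrite mulVf ?gt_eqF.
  by apply/sliceE; rewrite E; apply: KZ => //; rewrite invr_ge0 ltW.
rewrite [in RHS](cV_col_scalar y) scale_col_mx scale_scalar_mx -/s.
by rewrite mulVf ?gt_eqF.
Qed.

Lemma dtH_le k (A B : set 'cV[R]_k) d :
  (forall x, A x -> enorm x <= 1 ->
    exists y, [/\ B y, enorm y <= 1 & enorm (x - y) <= d]) ->
  (forall x, B x -> enorm x <= 1 ->
    exists y, [/\ A y, enorm y <= 1 & enorm (x - y) <= d]) ->
  (dtH A B <= d%:E)%E.
Proof.
move=> AB BA; rewrite /dtH /hausdorff ge_max; apply/andP; split.
  apply: ge_ereal_sup => _ [x [Ax x1] <-].
  have [y [By y1 xy]] := AB x Ax x1.
  apply: (@le_trans _ _ (enorm (x - y))%:E); last by rewrite lee_fin.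
  by apply: ereal_inf_lbound; exists y.
apply: ge_ereal_sup => _ [x [Bx x1] <-].
have [y [Ay y1 xy]] := BA x Bx x1.
apply: (@le_trans _ _ (enorm (x - y))%:E); last by rewrite lee_fin.
by apply: ereal_inf_lbound; exists y.
Qed.

Lemma norm_col_mx_sub (x y : 'cV[R]_n) (s t : R) :
  `|col_mx x s%:M - col_mx y t%:M| <= Num.max `|x - y| `|s - t|.
Proof.
rewrite opp_col_mx add_col_mx; apply: normr_le_coord => [|i].
  by rewrite le_max normr_ge0.
rewrite -[i]splitK; case: (split i) => j /=.
  by rewrite col_mxEu le_max normr_coord_le.
by rewrite col_mxEd !mxE (ord1 j) eqxx !mulr1n le_max lexx orbT.
Qed.

End Slices.

(** * Homogenization of the shadow and correctness of both outputs *)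

Section Homogenization.
Context {R : realType}.
Variables (n m l : nat) (D : shadow_data (R:=R) n m l).
Hypothesis symD : sym_data D.
Variables (xbar : 'cV[R]_n) (ybar : 'cV[R]_m) (delta : R).
Hypotheses (slater : pd (pencil D xbar ybar)) (delta0 : 0 < delta).

Local Notation T := (cone_data D).
Local Notation p := (startH xbar).
Local Notation dbar := ((enorm p)^-1 *: p).

Lemma startH_neq0 : p != 0.
Proof.
apply/eqP => /(congr1 (fun z : 'cV[R]_(n + 1) => dsubmx z 0 0)).
by rewrite col_mxKd !mxE eqxx => /eqP; rewrite oner_eq0.
Qed.

Let p_gt0 : 0 < enorm p. Proof. by rewrite enorm_gt0 startH_neq0. Qed.

Lemma cone_data_convex_cone : convex_cone (shadow T).
Proof. exact: shadow_convex_cone. Qed.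

Lemma shadow_startH : shadow T p.
Proof. by apply: shadow_cone_lift; exists ybar; exact: pd_psd. Qed.

(** The first program moves along the line through 0 and p, and passes to negative multiples of p
    after t = |p|. *)
Lemma startH_ray t : p + t *: - dbar = (1 - t / enorm p) *: p.
Proof. by rewrite scalerN scalerA scalerBl scale1r. Qed.

(* For n = 0 the block (x_(n+1) I) is empty and the shadow may be all of R. *)
Lemma shadow_last_ge0 : ~ P_unbounded T p (- dbar) ->
  forall z, shadow T z -> 0 <= dsubmx z 0 0.
Proof.
move=> nunb z; rewrite {1}(cV_col_scalar z); set s := dsubmx z 0 0 => Tz.
have [i _|n0] := pickP (@predT 'I_n); first exact: shadow_cone_last_ge0 i _ _ Tz.
rewrite leNgt; apply/negP => s0; apply: nunb => c.
(* For t >= |p| the factor 1 - t / |p| is nonpositive, and dividing it by s < 0 gives a nonnegative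
   multiple of z; the upper blocks agree because n = 0. *)
pose t := Num.max c (enorm p).
have tc : c <= t by rewrite le_max lexx.
have tp : enorm p <= t by rewrite le_max lexx orbT.
have [_ _ TZ] := cone_data_convex_cone.
have [y py] : shadow T (p + t *: - dbar).
  rewrite startH_ray.
  have -> : (1 - t / enorm p) *: p =
      ((1 - t / enorm p) / s) *: col_mx (usubmx z) s%:M.
    rewrite /startH col_mx1 !scale_col_mx !scale_scalar_mx divfK ?lt_eqF // mulr1.
    by congr col_mx; apply/colP => i; have := n0 i.
  apply: TZ Tz; rewrite -mulrNN -invrN divr_ge0 ?oppr_ge0 ?(ltW s0) //.
  by rewrite subr_le0 ler_pdivlMr // mul1r.
by exists t, (p + t *: - dbar), y.
Qed.

(** The conclusion expresses n = 0: given a coordinate, the last coordinate 1 - t / |p| is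
    nonnegative on T, which bounds t by |p|. *)
Lemma unbounded_all_eq : P_unbounded T p (- dbar) ->
  forall x y : 'cV[R]_n, x = y.
Proof.
move=> unb x y; apply/colP => i; exfalso.
have [t [z [y' [[pz zE] tc]]]] := unb (enorm p + 1).
have Tz : shadow T (col_mx (usubmx z) (dsubmx z 0 0)%:M).
  by rewrite -cV_col_scalar; exists y'.
have := shadow_cone_last_ge0 i Tz.
rewrite zE startH_ray linearZ /= col_mxKd !mxE eqxx mulr1 subr_ge0.
by rewrite ler_pdivrMr // mul1r; lra.
Qed.

Lemma slice_shadow : slice (shadow T) = shadow D.
Proof.
apply/seteqP; split=> x; last by move=> Sx; apply/sliceE; exact: shadow_cone_lift.
move=> /sliceE /(shadow_cone_scale ltr01).
by rewrite invr1 scale1r.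
Qed.

Section Bounded.
Hypothesis nunb : ~ P_unbounded T p (- dbar).

Lemma homog_shadow : homog (shadow D) = closure (shadow T).
Proof.
rewrite -slice_shadow; apply/seteqP; split.
  apply: closureS; apply: cone_sub cone_data_convex_cone _.
  exact: lift1_slice.
have /closure_id -> : closed (homog (slice (shadow T))) by exact: closed_closure.
apply: closureS; apply: sub_homog_slice cone_data_convex_cone shadow_startH _.
exact: shadow_last_ge0.
Qed.

Lemma lift1_closure x : closure (shadow D) x -> closure (shadow T) (col_mx x 1).
Proof.
move=> /closure_normP Sx; apply/closure_normP => e e0.
have [y Sy xy] := Sx e e0; exists (col_mx y 1); first exact: shadow_cone_lift.
apply: le_lt_trans (norm_col_mx_sub _ _ _ _) _.
by rewrite subrr normr0 gt_max xy.
Qed.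

(** A point (y, s) of T near (x, 1) has s near 1, so the point y / s of S is near x. *)
Lemma slice_closure : slice (closure (shadow T)) `<=` closure (shadow D).
Proof.
move=> x /sliceE /closure_normP Tx; apply/closure_normP => e e0.
(* The first term of q gives (e / q)(1 + |x|) < e / 2, the second e / q <= 1 / 2 and hence s > 1 /
   2. *)
pose q := 2 * (1 + `|x|) + 2 * e.
have x0 : 0 <= `|x| by [].
have q0 : 0 < q by rewrite /q; lra.
have [z] := Tx (e / q) (divr_gt0 e0 q0).
rewrite {1 2}(cV_col_scalar z); set y := usubmx z; set s := dsubmx z 0 0 => Tz xz.
have xy : `|x - y| < e / q.
  apply: le_lt_trans xz; apply: normr_le_coord => [|i]; first exact: normr_ge0.
  have := normr_coord_le (col_mx x 1 - col_mx y s%:M) (lshift 1 i).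
  by rewrite opp_col_mx add_col_mx col_mxEu.
have xs : `|1 - s| < e / q.
  apply: le_lt_trans xz.
  have := normr_coord_le (col_mx x 1 - col_mx y s%:M) (rshift n 0).
  by rewrite opp_col_mx add_col_mx col_mxEd !mxE eqxx.
have eq2 : e / q <= 2^-1 by rewrite ler_pdivrMr // /q; lra.
have s2 : 2^-1 < s by have := ler_norm (1 - s); lra.
have s0 : 0 < s by lra.
exists (s^-1 *: y); first exact: shadow_cone_scale.
have -> : x - s^-1 *: y = s^-1 *: ((x - y) - (1 - s) *: x).
  apply/colP => i; rewrite !mxE; field; by rewrite gt_eqF.
rewrite normrZ gtr0_norm ?invr_gt0 // mulrC ltr_pdivrMr //.
apply: le_lt_trans (ler_normB _ _) _; rewrite normrZ.
have H1 : `|1 - s| * `|x| <= e / q * `|x| by rewrite ler_wpM2r // ltW.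
have H2 : e / q * (1 + `|x|) < e * 2^-1.
  rewrite mulrAC -mulrA ltr_pM2l // ltr_pdivrMr // /q; lra.
have H3 : e * 2^-1 < e * s by rewrite ltr_pM2l.
lra.
Qed.

Section Pair.
Variables KO KI : set 'cV[R]_(n + 1).
Hypothesis inv : pair_invariant T p KO KI.
Hypothesis vs : forall r, box_vertices KO r -> near_cone delta KI r.

Lemma pair_approx x : KO x -> enorm x <= 1 ->
  exists y, [/\ KI y, enorm y <= 1 & enorm (x - y) <= delta].
Proof.
move=> KOx x1; apply: near_cone_ball => //.
  by have [hs ->] := pair_inner inv; exact: convex_cone_pcone.
apply: (near_cone_box _ inv) => //; exact: le_trans (normr_le_enorm _) x1.
Qed.

Lemma closure_shadow_outer : closure (shadow T) `<=` KO.
Proof.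
have [hs E] := pair_outer inv; have /closure_id -> : closed KO.
  by rewrite E; exact: closed_pcone.
exact/closureS/(pair_shadow_outer inv).
Qed.

(** The homogenization of P_O lies in K_O, whose points in the ball are within delta of K_I and so
    of cl T. The opposite distance vanishes by inclusion. *)
Lemma outer_correct : outer_homog_approx delta (shadow D) (slice KO).
Proof.
have [hs E] := pair_outer inv.
split; last by move=> x /lift1_closure /closure_shadow_outer ?; apply/sliceE.
split; first by rewrite E; exact: slice_pcone_polyhedron.
rewrite homog_shadow; apply: dtH_le => x.
  move=> PKx x1; have KOx : KO x.
    rewrite E in PKx *.
    exact: (homog_sub (convex_cone_pcone hs) (@closed_pcone _ _ hs) (@lift1_slice _ _ _)).
  have [y [KIy y1 xy]] := pair_approx KOx x1.
  by exists y; split=> //; exact: pair_inner_shadow inv _ KIy.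
rewrite -homog_shadow => Sx x1; exists x; split=> //; last by rewrite subrr enorm0 ltW.
apply: closureS Sx; apply: cone_sub (convex_cone_cone _) _ => _ [z Sz <-].
apply: sub_cone; exists z => //; apply/sliceE/closure_shadow_outer.
by apply: subset_closure; exact: shadow_cone_lift.
Qed.

(** Here K_I itself must lie in the homogenization of its slice. This holds because K_I contains p,
    of height 1, and has no point of negative height. *)
Lemma inner_correct : inner_homog_approx delta (shadow D) (slice KI).
Proof.
have [hs E] := pair_inner inv; have cKI : convex_cone KI.
  by rewrite E; exact: convex_cone_pcone.
have KIp : KI (col_mx xbar 1).
  have -> : col_mx xbar 1 = enorm p *: dbar by rewrite scalerA mulfV ?gt_eqF // scale1r.
  by have [_ _ KZ] := cKI; apply: KZ; [exact: enorm_ge0|exact: pair_dbar inv].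
have KIge z : KI z -> 0 <= dsubmx z 0 0.
  move=> /(pair_inner_shadow inv) Tz.
  have := @closed_halfspace _ _ (- col_mx 0 1 : 'cV[R]_(n + 1)) 0 => /closure_id clH.
  have : halfspace (- col_mx 0 1) 0 z.
    rewrite clH; apply: closureS Tz => y /(shadow_last_ge0 nunb).
    by rewrite /halfspace /= dotNl dot_last oppr_le0.
  by rewrite /halfspace /= dotNl dot_last oppr_le0.
split; last first.
  by move=> x /sliceE /(pair_inner_shadow inv) Tx; apply: slice_closure; apply/sliceE.
split; first by rewrite E; exact: slice_pcone_polyhedron.
rewrite homog_shadow; apply: dtH_le => x.
  move=> PKx x1; exists x; split=> //; last by rewrite subrr enorm0 ltW.
  apply: homog_sub PKx; [exact: closure_shadow_cone|exact: closed_closure|].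
  by move=> z /lift1_slice /(pair_inner_shadow inv).
move=> /closure_shadow_outer KOx x1; have [y [KIy y1 xy]] := pair_approx KOx x1.
by exists y; split=> //; exact: sub_homog_slice cKI KIp KIge _ KIy.
Qed.

End Pair.
End Bounded.

(** Here n = 0, so the nonempty set S is the whole space, as are both returned sets. *)
Lemma unbounded_correct : P_unbounded T p (- dbar) ->
  outer_homog_approx delta (shadow D) (slice setT) /\
  inner_homog_approx delta (shadow D) (slice setT).
Proof.
move=> unb; have S : shadow D = setT.
  apply/seteqP; split=> // x _; rewrite (unbounded_all_eq unb x xbar).
  by exists ybar; exact: pd_psd.
have -> : slice (setT : set 'cV[R]_(n + 1)) = setT.
  by apply/seteqP; split=> // x _; apply/sliceE.
have app : homog_approx delta (setT : set 'cV[R]_n) setT.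
  split; first by exists [::]; apply/seteqP; split.
  apply: dtH_le => x Ax x1; exists x; split=> //; by rewrite subrr enorm0 ltW.
by rewrite S; split; split=> //; exact: subset_closure.
Qed.

Lemma reachableH_invariant s : reachableH D xbar delta s -> state_invariant T p delta s.
Proof.
have [y py] := cone_data_slater slater.
move=> reach; elim: {s reach}(clos_rt_rtn1 _ _ _ _ reach) => [//|s1 s2 st _ IH].
exact: (invariant_step _ py startH_neq0 delta0 IH st).
Qed.

End Homogenization.

Theorem theorem4p3 (R : realType) (n m l : nat)
    (D : @shadow_data R n m l) (symD : sym_data D)
    (xbar : 'cV[R]_n) (delta : R) :
  interior (shadow D) xbar ->
  (exists y : 'cV[R]_m, pd (pencil D xbar y)) ->
  0 < delta ->
  [/\ never_stuckH D xbar delta,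
      terminatesH D xbar delta &
      forall PO PI : set 'cV[R]_n, returnsH D xbar delta PO PI ->
        outer_homog_approx delta (shadow D) PO /\
        inner_homog_approx delta (shadow D) PI].
Proof.
move=> _ [ybar slater] delta0; have symT := sym_cone_data symD.
have [y py] := cone_data_slater slater; have p0 := startH_neq0 xbar.
have acc KO KI : Acc (fun s' s => stepH D xbar delta s s') (Pass KO KI).
  exact: (stepR_terminates symT _ py p0 delta0).
split.
- move=> s reach; have inv := reachableH_invariant slater delta0 reach.
  exact: (invariant_progress symT py inv).
- move=> [f [f0 fS]].
  have noacc s : Acc (fun s' s => stepH D xbar delta s s') s ->
      forall i, f i = s -> False.
    elim=> {}s _ IH i fi; apply: (IH (f i.+1) _ i.+1) => //.
    by rewrite -fi; exact: fS.
  (* The first step leads to [Done], which has no successor, or to a [Pass] state, which is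
     accessible. *)
  have st := fS 0%N; rewrite f0 in st; inversion st as [unb e f1|V w ? ? e f1| | | | | | | ].
    by have := fS 1%N; rewrite -f1 => st'; inversion st'.
  exact: noacc (acc _ _) 1%N (esym f1).
- move=> _ _ [KO [KI [reach -> ->]]].
  have := reachableH_invariant slater delta0 reach.
  move=> [[unb -> ->]|[inv vs]]; first exact: unbounded_correct slater delta0 unb.
  have nunb := pair_bounded inv.
  split; first exact: (outer_correct slater delta0 nunb inv vs).
  exact: (inner_correct slater delta0 nunb inv vs).
Qed.
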